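(* Assume that $Y\cap\mathbb{Z}^m$ is finite. Let $p\in[1,\infty)$, let $(\Omega,\mathcal{F},\mathbb{P})$ be an atomless probability space, and let $\rho:\mathcal{L}^p(\Omega,\mathcal{F},\mathbb{P})\to\mathbb{R}$ be convex, nondecreasing and law-invariant. Let $\mathcal{M}\subseteq\mathcal{M}(X)$ be locally uniformly $\|\cdot\|^p$-integrating and let $\mu\in\mathcal{M}$ have a uniformly bounded Lebesgue density. Then: 1. The restriction $\xi_{\mathbb{R}^n}|_{\mathcal{M}}$ is upper semicontinuous at $\mu$ with respect to the topology of weak convergence on $\mathcal{M}$. In addition, assume that $\Xi_V(\mu)$ is a complete local minimizing (CLM) set of $(P_\mu)$ with respect to some open bounded set $V\subset\mathbb{R}^n$. Then: 2. The restriction $\xi_V|_{\mathcal{M}}$ is continuous at $\mu$ with respect to the topology of weak convergence on $\mathcal{M}$. 3. The restriction $\Xi_V|_{\mathcal{M}}$ is upper semicontinuous at $\mu$ with respect to the topology of weak convergence on $\mathcal{M}$ in the sense of Berge, i.e. for any open set $O\subseteq\mathbb{R}^n$ with $\Xi_V(\mu)\subset O$ there exists a weakly open neighborhood $N$ of $\mu$ such that $\Xi_V(\nu)\subseteq O$ for all $\nu\in N\cap\mathcal{M}$.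
   Context: Let $X\subseteq\mathbb{R}^n$ be a nonempty polyhedron, $c\in\mathbb{R}^n$, $T\in\mathbb{R}^{s\times n}$, $W\in\mathbb{R}^{s\times m}$, $q,d\in\mathbb{R}^m$, and $Y\subseteq\mathbb{R}^m$ with $Y\cap\mathbb{Z}^m\neq\emptyset$. For $t\in\mathbb{R}^s$ let $\Psi(t):=\operatorname{Argmin}_y\{d^\top y \mid Wy\le t,\ y\in Y\cap\mathbb{Z}^m\}$ and $\varphi(t):=\inf_y\{q^\top y\mid y\in\Psi(t)\}\in\mathbb{R}\cup\{\pm\infty\}$, with $\inf\emptyset=+\infty$. Let $f(x,z):=c^\top x+\varphi(Tx+z)$ for $(x,z)\in\mathbb{R}^n\times\mathbb{R}^s$, and let $\operatorname{dom}f$ be the set where $f$ is finite. $\mathcal{P}(\mathbb{R}^k)$ denotes the Borel probability measures on $\mathbb{R}^k$, endowed with the topology of weak convergence, and $\mathcal{M}(X):=\{\mu\in\mathcal{P}(\mathbb{R}^s)\mid X\times\operatorname{supp}\mu\subseteq\operatorname{dom}f\}$. For $x\in X$, $\mu\in\mathcal{M}(X)$, let $\delta_x$ be the Dirac measure at $x$; when $Y\cap\mathbb{Z}^m$ is finite, $(\delta_x\otimes\mu)\circ f^{-1}\in\mathcal{P}(\mathbb{R})$ has bounded support, so, the space being atomless, there is $Z_{(x,\mu)}\in\mathcal{L}^p(\Omega,\mathcal{F},\mathbb{P})$ with distribution $\mathbb{P}\circ Z_{(x,\mu)}^{-1}=(\delta_x\otimes\mu)\circ f^{-1}$. Define $\mathcal{Q}_\rho:X\times\mathcal{M}(X)\to\mathbb{R}$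 by $\mathcal{Q}_\rho(x,\mu):=\rho[Z_{(x,\mu)}]$; this is well defined because $\rho$ is law-invariant (i.e. $\rho[Y_1]=\rho[Y_2]$ whenever $Y_1,Y_2$ have the same distribution). $\rho$ is nondecreasing if $\rho[Y_1]\le\rho[Y_2]$ whenever $Y_1\le Y_2$ $\mathbb{P}$-a.s. A set $\mathcal{M}\subseteq\mathcal{M}_s^p:=\{\nu\in\mathcal{P}(\mathbb{R}^s)\mid\int_{\mathbb{R}^s}\|t\|^p\,\nu(\mathrm{d}t)<\infty\}$ is called locally uniformly $\|\cdot\|^p$-integrating if for every sequence $\{\mu_n\}_{n\in\mathbb{N}}\subseteq\mathcal{M}$ converging weakly to some $\mu\in\mathcal{M}$ one has $\lim_{n\to\infty}\int\|t\|^p\,\mu_n(\mathrm{d}t)=\int\|t\|^p\,\mu(\mathrm{d}t)$. $(P_\mu)$ is the problem $\min_x\{\mathcal{Q}_\rho(x,\mu)\mid x\in X\}$. For an open set $V\subseteq\mathbb{R}^n$, the localized optimal value function $\xi_V:\mathcal{M}(X)\to\mathbb{R}\cup\{\pm\infty\}$ is $\xi_V(\mu):=\inf_x\{\mathcal{Q}_\rho(x,\mu)\mid x\in X\cap\operatorname{cl}V\}$ and the localized optimal solution set mapping $\Xi_V:\mathcal{M}(X)\rightrightarrows\mathbb{R}^n$ is $\Xi_V(\mu):=\operatorname{Argmin}_x\{\mathcal{Q}_\rho(x,\mu)\mid x\in X\cap\operatorname{cl}V\}$. For $\mu\in\mathcal{M}(X)$ and $V$ open, $\Xi_V(\mu)$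 is a complete local minimizing (CLM) set of $(P_\mu)$ with respect to $V$ if $\emptyset\neq\Xi_V(\mu)\subseteq V$. *)

(* Defs.v *)
From HB Require Import structures.
From mathcomp Require Import all_boot all_order all_algebra.
From mathcomp Require Import all_classical all_reals all_analysis.

Set Implicit Arguments.
Unset Strict Implicit.
Unset Printing Implicit Defensive.

Import Order.TTheory GRing.Theory Num.Theory.
Import numFieldNormedType.Exports.

Local Open Scope classical_set_scope.
Local Open Scope ring_scope.

Section vectors.
Context {R : realType}.

Definition dotp k (u v : 'cV[R]_k) : R := (u^T *m v) ord0 ord0.

(* Componentwise order on column vectors. *)
Definition lev k (u v : 'cV[R]_k) : Prop := forall i, u i ord0 <= v i ord0.

(* The canonical norm `|u| on matrices is the maximum norm. *)
Definition enorm k (u : 'cV[R]_k) : R := Num.sqrt (\sum_i u i ord0 ^+ 2).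

Definition integral_vectors k : set 'cV[R]_k :=
  [set y | forall i, y i ord0 \is a Num.int].

Definition polyhedron k (X : set 'cV[R]_k) : Prop :=
  exists (l : nat) (A : 'M[R]_(l, k)) (b : 'cV[R]_l), X = [set x | lev (A *m x) b].

End vectors.

Arguments integral_vectors {R k}.

Notation borelRn R k := (g_sigma_algebraType (@open 'cV[R]_k)).

(* The topology of weak convergence on the Borel probability measures of R^k is
   the coarsest one for which mu |-> \int h dmu is continuous for every bounded
   continuous h : R^k -> R. *)
Section weak_convergence.
Variables (R : realType) (k : nat).

Definition bounded_continuous (h : 'cV[R]_k -> R) : Prop :=
  continuous h /\ exists C : R, forall x, `|h x| <= C.

Definition expectations (mu : probability (borelRn R k) R) :
    {ptws {h | bounded_continuous h} -> R} :=
  fun h => (\int[mu]_x (sval h x : R))%R.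

Definition probRn : Type := initial_topology expectations.

HB.instance Definition _ := Topological.on probRn.

End weak_convergence.

Section probability_measures.
Context {R : realType} {k : nat}.
Implicit Types mu : probability (borelRn R k) R.

Definition support mu : set 'cV[R]_k :=
  [set z | forall U : set 'cV[R]_k, open U -> U z -> (0 < mu U)%E].

(* Lebesgue measure on R^k is the unique Borel measure giving every closed box
   its volume; the library constructs it only for k = 1. *)
Definition is_lebesgue (lam : {measure set (borelRn R k) -> \bar R}) : Prop :=
  forall a b : 'cV[R]_k, lev a b ->
    lam [set x : 'cV[R]_k | lev a x /\ lev x b] =
    (\prod_i (b i ord0 - a i ord0))%:E.

Definition bounded_lebesgue_density mu : Prop :=
  exists2 lam : {measure set (borelRn R k) -> \bar R}, is_lebesgue lam &
  exists (g : borelRn R k -> R) (C : R),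
    [/\ measurable_fun setT g, (forall x, 0 <= g x <= C) &
        forall A : set (borelRn R k), measurable A ->
          mu A = (\int[lam]_(x in A) (g x)%:E)%E].

Definition pth_moment (p : R) mu : \bar R :=
  (\int[mu]_t (enorm (t : 'cV[R]_k) `^ p)%:E)%E.

Definition locally_uniformly_integrating (p : R) (M : set (probRn R k)) : Prop :=
  (forall nu, M nu -> (pth_moment p nu < +oo)%E) /\
  forall (mus : nat -> probRn R k) (mu : probRn R k),
    (forall j, M (mus j)) -> M mu -> mus j @[j --> \oo] --> mu ->
    pth_moment p (mus j) @[j --> \oo] --> pth_moment p mu.

End probability_measures.

Section risk_functionals.
Context d {Omega : measurableType d} {R : realType} (P : probability Omega R).

Definition atomless : Prop :=
  forall A, measurable A -> (0 < P A)%E ->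
    exists B, [/\ measurable B, B `<=` A, (0 < P B)%E & (P B < P A)%E].

Context (p : \bar R) (p1 : (1 <= p)%E) (rho : LfunType P p1 -> R).

Definition risk_convex : Prop :=
  forall (Z1 Z2 : LfunType P p1) (a : R), 0 <= a <= 1 ->
    rho (a *: Z1 + (1 - a) *: Z2) <= a * rho Z1 + (1 - a) * rho Z2.

Definition risk_nondecreasing : Prop :=
  forall Z1 Z2 : LfunType P p1,
    {ae P, forall w, Z1 w <= Z2 w} -> rho Z1 <= rho Z2.

Definition law_invariant : Prop :=
  forall Z1 Z2 : LfunType P p1,
    (forall B : set (measurableTypeR R), measurable B ->
      distribution P Z1 B = distribution P Z2 B) ->
    rho Z1 = rho Z2.

End risk_functionals.

Record bilevel_data (R : realType) (n m s : nat) := BilevelData {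
  Xset : set 'cV[R]_n;
  cvec : 'cV[R]_n;
  Tmx : 'M[R]_(s, n);
  Wmx : 'M[R]_(s, m);
  qvec : 'cV[R]_m;
  dvec : 'cV[R]_m;
  Yset : set 'cV[R]_m
}.

Section bilevel_problem.
Context {R : realType} {n m s : nat} (D : bilevel_data R n m s).

Definition lower_feasible : set 'cV[R]_m := Yset D `&` integral_vectors.

Definition Psi (t : 'cV[R]_s) : set 'cV[R]_m :=
  [set y | (lower_feasible y /\ lev (Wmx D *m y) t) /\
    forall y', lower_feasible y' -> lev (Wmx D *m y') t ->
      dotp (dvec D) y <= dotp (dvec D) y'].

Definition phi (t : 'cV[R]_s) : \bar R :=
  ereal_inf [set (dotp (qvec D) y)%:E | y in Psi t].

Definition objf (xz : 'cV[R]_n * 'cV[R]_s) : \bar R :=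
  ((dotp (cvec D) xz.1)%:E + phi (Tmx D *m xz.1 + xz.2))%E.

Definition domf : set ('cV[R]_n * 'cV[R]_s) := [set xz | objf xz \is a fin_num].

Definition MX : set (probRn R s) :=
  [set mu | Xset D `*` support mu `<=` domf].

(* (\d_x \x mu) o objf^-1 as a distribution on the real line: for x in X and
   mu in MX, objf is almost surely finite. *)
Definition objf_law (x : 'cV[R]_n) (mu : probability (borelRn R s) R)
    (B : set R) : \bar R :=
  (\d_(x : borelRn R n) \x mu)%E
    (objf @^-1` (EFin @` B) : set (borelRn R n * borelRn R s)).

Section risk_averse.
Context d {Omega : measurableType d} {P : probability Omega R}.
Context {p : \bar R} {p1 : (1 <= p)%E} (rho : LfunType P p1 -> R).

(* For mu outside MX there need not be such a variable, and 0 is returned. *)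
Definition objf_rv (x : 'cV[R]_n) (mu : probRn R s) : LfunType P p1 :=
  xget 0 [set Z : LfunType P p1 | forall B : set (measurableTypeR R),
            measurable B -> distribution P Z B = objf_law x mu B].

Definition Qrho (x : 'cV[R]_n) (mu : probRn R s) : R := rho (objf_rv x mu).

Definition xiV (V : set 'cV[R]_n) (mu : probRn R s) : \bar R :=
  ereal_inf [set (Qrho x mu)%:E | x in Xset D `&` closure V].

Definition XiV (V : set 'cV[R]_n) (mu : probRn R s) : set 'cV[R]_n :=
  [set x | (Xset D `&` closure V) x /\
    forall x', (Xset D `&` closure V) x' -> Qrho x mu <= Qrho x' mu].

Definition CLM_set (V : set 'cV[R]_n) (mu : probRn R s) : Prop :=
  XiV V mu !=set0 /\ XiV V mu `<=` V.

End risk_averse.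

End bilevel_problem.

Section restricted_continuity.
Context {R : realType} {S : topologicalType} (M : set S).

Definition usc_within_at (f : S -> \bar R) (mu : S) : Prop :=
  forall a : R, (f mu < a%:E)%E ->
    \forall nu \near within M (nbhs mu), (f nu < a%:E)%E.

Definition continuous_within_at (f : S -> \bar R) (mu : S) : Prop :=
  f nu @[nu --> within M (nbhs mu)] --> f mu.

Definition berge_usc_within_at {T : topologicalType} (F : S -> set T) (mu : S) :=
  forall O : set T, open O -> F mu `<=` O ->
    exists N : set S, [/\ open N, N mu &
      forall nu, N nu -> M nu -> F nu `<=` O].

End restricted_continuity.

(* Main.v *)
Require Import Defs.
From HB Require Import structures.
From mathcomp Require Import all_boot all_order all_algebra.
From mathcomp Require Import all_classical all_reals all_analysis.
From mathcomp Require Import measurable_realfun ring lra.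

Set Implicit Arguments.
Unset Strict Implicit.
Unset Printing Implicit Defensive.

Import Order.TTheory GRing.Theory Num.Theory.
Import numFieldNormedType.Exports.

Local Open Scope classical_set_scope.
Local Open Scope ring_scope.

(** Everything follows from one fact: the map sending [(x, nu)] to
    [Qrho D rho x nu], restricted to feasible [x] and to [nu] in [M], is jointly
    continuous at every point [(x0, mu)] ([Qrho_jointly_continuous]).  Upper
    semicontinuity of [xiV] is then that of an infimum of continuous functions,
    and over the compact set [Xset D `&` closure V] lower bounds that hold for
    [mu] persist uniformly for nearby measures, by a covering argument
    ([Qrho_gt_on_compact]); this gives the continuity of [xiV], and, applied to
    the part of the feasible set outside [O], the Berge semicontinuity.

    Joint continuity rests on three ingredients.

    First, the lower level has finitely many candidates [y], so [phi t] depends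
    only on which of the inequalities [(W y)_i <= t_i] hold.  Hence the
    hyperplanes [t_i = (W y)_i] cut the parameter space into cells, on each of
    which [phi] is constant ([phi_cell_congr]), and the law of [objf x] under
    [nu] is given by finitely many cell masses, attached to values that move
    continuously with [x] ([objf_lawE]).  A measure with a density does not
    charge hyperplanes ([density_hyperplane]), so a portmanteau argument, with
    the translation by [T x] as an additional parameter, shows that the cell
    masses are continuous at [(x0, mu)] ([weak_cell_continuous]).

    Second, on an atomless space nearby discrete laws can be realised by
    variables that coincide outside an event of small probability
    ([atomless_coupling], built on the intermediate value property
    [atomless_intermediate]).  As [rho] is law-invariant, it may be evaluated on
    these variables ([Qrho_cell_coding]).

    Third, a finite convex nondecreasing functional on L^p is continuous along
    uniformly bounded perturbations that are small in probability
    ([risk_continuous_in_probability]).  This is a special case of the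
    continuity of finite convex monotone functionals on Banach lattices, with
    the same proof: a sequence of counterexamples can be dominated by
    [G / (k+1)] for a single [G] in L^p, which contradicts convexity along the
    direction [G]. *)

(** * Atomless probability spaces *)

Section probability_values.
Context d {Omega : measurableType d} {R : realType} (P : probability Omega R).
Implicit Types A B C : set Omega.

Definition prb A : R := fine (P A).

Lemma prbE A : measurable A -> P A = (prb A)%:E.
Proof. by move=> mA; rewrite /prb fineK// fin_num_measure. Qed.

Lemma prb_ge0 A : 0 <= prb A.
Proof. by rewrite /prb fine_ge0. Qed.

Lemma prbT : prb setT = 1.
Proof. by rewrite /prb probability_setT. Qed.

Lemma prb0 : prb set0 = 0.
Proof. by rewrite /prb measure0. Qed.

Lemma le_prb A B : measurable A -> measurable B -> A `<=` B -> prb A <= prb B.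
Proof.
by move=> mA mB AB; rewrite -lee_fin -!prbE// le_measure ?inE.
Qed.

Lemma prb_le1 A : measurable A -> prb A <= 1.
Proof. by move=> mA; rewrite -prbT le_prb. Qed.

Lemma prbU A B : measurable A -> measurable B -> A `&` B = set0 ->
  prb (A `|` B) = prb A + prb B.
Proof.
move=> mA mB AB; apply: EFin_inj; rewrite EFinD -!prbE//; last exact: measurableU.
by rewrite measureU.
Qed.

Lemma prbD A B : measurable A -> measurable B -> B `<=` A ->
  prb (A `\` B) = prb A - prb B.
Proof.
move=> mA mB BA.
have := @prbU (A `\` B) B (measurableD mA mB) mB.
rewrite setDE -setIA setICl setI0 => /(_ erefl).
by rewrite -setDE setUC setDUK// => ->; rewrite addrK.
Qed.

Lemma prb_bigU (n : nat) (F : nat -> set Omega) :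
  (forall i, measurable (F i)) -> trivIset setT F ->
  prb (\big[setU/set0]_(i < n) F i) = \sum_(i < n) prb (F i).
Proof.
move=> mF tF; apply: EFin_inj.
rewrite -prbE; last exact: bigsetU_measurable.
rewrite measure_bigsetU// -sumEFin; apply: eq_bigr => i _; exact: prbE.
Qed.

End probability_values.

Section atomless_range.
Context d {Omega : measurableType d} {R : realType} (P : probability Omega R).
Hypothesis P_atomless : atomless P.
Implicit Types A B C : set Omega.
Notation pr := (prb P).

(** The smaller of the two pieces into which an event of positive mass splits. *)
Lemma atomless_half A : measurable A -> 0 < pr A ->
  exists B, [/\ measurable B, B `<=` A, 0 < pr B & 2 * pr B <= pr A].
Proof.
move=> mA A0.
have [|B [mB BA B0 BltA]] := P_atomless mA; first by rewrite prbE// lte_fin.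
have [h|h] := leP (2 * pr B) (pr A).
  by exists B; split => //; rewrite -lte_fin -prbE.
exists (A `\` B); split; [exact: measurableD|exact: subDsetl| |].
  by rewrite prbD// subr_gt0 -lte_fin -!prbE.
by rewrite prbD//; lra.
Qed.

Lemma atomless_small A (e : R) : measurable A -> 0 < pr A -> 0 < e ->
  exists B, [/\ measurable B, B `<=` A, 0 < pr B & pr B <= e].
Proof.
move=> mA A0 e0.
have H (k : nat) :
    exists B, [/\ measurable B, B `<=` A, 0 < pr B & k%:R * pr B <= 1].
  elim: k => [|k [B [mB BA B0 kB]]].
    by exists A; split => //; rewrite mul0r.
  have [C [mC CB C0 CB2]] := atomless_half mB B0.
  exists C; split => //; first exact: subset_trans CB BA.
  case: k kB => [_|k kB]; first by rewrite mul1r prb_le1.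
  rewrite -natr1 mulrDl mul1r.
  have : k.+1%:R * (2 * pr C) <= 1.
    by apply: le_trans kB; rewrite ler_pM2l// ltr0Sn.
  have k1 : (1:R) <= k.+1%:R by rewrite ler1n.
  nra.
have [k ek] : exists k : nat, e^-1 <= k%:R.
  by exists (Num.bound e^-1); rewrite ltW// archi_boundP// invr_ge0 ltW.
have [B [mB BA B0 kB]] := H k.
exists B; split => //.
have : e^-1 * pr B <= 1 by apply: le_trans kB; rewrite ler_pM2r.
by rewrite mulrC ler_pdivrMr// mul1r.
Qed.

(** Exhaustion: a greedy sequence, each step of which adds at least half of the
    largest mass that still fits, can only stop short of [a] if no subset of
    the remainder has a mass small enough to fit, which [atomless_small]
    excludes. *)
Lemma atomless_intermediate A (a : R) : measurable A -> 0 <= a <= pr A ->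
  exists B, [/\ measurable B, B `<=` A & pr B = a].
Proof.
move=> mA /andP[a0 aA].
pose packed (B : set Omega) := [/\ measurable B, B `<=` A & pr B <= a].
pose X := {B : set Omega | packed B}.
pose fits (B C : set Omega) :=
  [/\ measurable C, C `<=` A `\` B & pr B + pr C <= a].
pose next (B B' : X) := sval B `<=` sval B' /\
  forall C, fits (sval B) C -> pr C <= 2 * (pr (sval B') - pr (sval B)).
have step (B : X) : {B' | next B B'}.
  apply: cid; case: B => B [mB BA Ba].
  pose S : set R := [set pr C | C in fits B].
  have S0 : S 0 by exists set0; rewrite ?prb0//; split; rewrite ?prb0 ?addr0.
  have hsS : has_sup S.
    split; first by exists 0.
    by exists 1 => _ [C [mC _ _] <-]; exact: prb_le1.
  have supS0 : 0 <= sup S by apply: ub_le_sup => //; case: hsS.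
  have [s0|s0] := eqVneq (sup S) 0.
    exists (exist packed B (And3 mB BA Ba)); split => //= C fC.
    by rewrite subrr mulr0 -s0; apply: ub_le_sup; [case: hsS|exists C].
  have s2 : 0 < sup S / 2 by rewrite divr_gt0// lt_neqAle eq_sym s0.
  have [_ [C [mC CA BC] <-] sC] := sup_adherent s2 hsS.
  have BC0 : B `&` C = set0.
    by apply/seteqP; split => // w [Bw /CA[]].
  have prBC : pr (B `|` C) = pr B + pr C by rewrite prbU.
  have BCX : packed (B `|` C).
    rewrite /packed prBC; split => //; first exact: measurableU.
    by move=> w [/BA//|/CA[]].
  exists (exist packed _ BCX); split => //= C' fC'; rewrite prBC.
  have : pr C' <= sup S by apply: ub_le_sup; [case: hsS|exists C'].
  lra.
have X0 : packed set0 by rewrite /packed prb0; split.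
have [f [_ fS]] := dependent_choice step (exist packed _ X0).
pose F n := sval (f n).
have mF n : measurable (F n) by rewrite /F; case: (f n) => ? [].
have FA n : F n `<=` A by rewrite /F; case: (f n) => ? [].
have Fa n : pr (F n) <= a by rewrite /F; case: (f n) => ? [].
have ndF : {homo F : n m / (n <= m)%N >-> (n <= m)%O}.
  by apply: homo_leq => [//|? ? ?|n]; [exact: le_trans|
    by rewrite subsetEset; case: (fS n)].
have mU : measurable (\bigcup_n F n) by exact: bigcup_measurable.
have cvF : (pr \o F) n @[n --> \oo] --> pr (\bigcup_n F n).
  have /fine_cvgP[_] : (P \o F) n @[n --> \oo] --> (pr (\bigcup_n F n))%:E.
    by rewrite -prbE//; exact: nondecreasing_cvg_mu.
  exact.
have leU n : pr (F n) <= pr (\bigcup_n F n).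
  by apply: le_prb => //; exact: bigcup_sup.
exists (\bigcup_n F n); split => //; first exact: bigcup_sub.
apply/eqP; rewrite eq_le; apply/andP; split.
  by apply: cvgr_to_le cvF _; exact: nearW.
rewrite leNgt; apply/negP => Ua.
have UA : \bigcup_n F n `<=` A by exact: bigcup_sub.
have [||C [mC CU C0 CaU]] := @atomless_small (A `\` \bigcup_n F n)
    (a - pr (\bigcup_n F n)) (measurableD mA mU).
  by rewrite prbD// subr_gt0 (lt_le_trans Ua).
  by rewrite subr_gt0.
have grow n : pr C <= 2 * (pr (F n.+1) - pr (F n)).
  have [_] := fS n; apply; split => //.
    by move=> w /CU[Aw nUw]; split => // Fw; apply: nUw; exists n.
  have := leU n; rewrite /F; lra.
have big n : n%:R * pr C <= 2 * pr (F n).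
  elim: n => [|n ih]; first by rewrite mul0r mulr_ge0// prb_ge0.
  by rewrite -natr1 mulrDl mul1r; have := grow n; lra.
pose n := Num.bound (2 / pr C).
have : 2 / pr C < n%:R by apply: archi_boundP; rewrite divr_ge0// ltW.
rewrite ltr_pdivrMr// => h; have := big n.
by have := prb_le1 P (mF n); lra.
Qed.

End atomless_range.

Section coupling.
Context d {Omega : measurableType d} {R : realType} (P : probability Omega R).
Hypothesis P_atomless : atomless P.
Notation pr := (prb P).

Lemma atomless_split (n : nat) (w : nat -> R) (A : set Omega) :
  measurable A -> (forall i, 0 <= w i) -> \sum_(i < n) w i <= pr A ->
  exists C : nat -> set Omega, [/\ forall i, measurable (C i),
    forall i, C i `<=` A, trivIset setT C &
    forall i, (i < n)%N -> pr (C i) = w i].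
Proof.
move=> + w0; elim: n A => [|n ih] A mA.
  by exists (fun=> set0); split => // [i x|i j _ _ [x []]].
rewrite big_ord_recr /= => wA.
have sw0 : 0 <= \sum_(i < n) w i by exact: sumr_ge0.
have [|B [mB BA Bw]] := atomless_intermediate P_atomless (a := w n) mA.
  by rewrite w0; lra.
have [||C [mC CA tC Cw]] := ih (A `\` B); first exact: measurableD.
  by rewrite prbD// Bw; lra.
exists (fun i => if i == n then B else if (i < n)%N then C i else set0).
split => [i|i|i j _ _|i].
- by case: ifP => // _; case: ifP.
- by case: ifP => // _; case: ifP => _ x // /CA[].
- have [->|ni] := eqVneq i n; have [->|nj] := eqVneq j n => //.
  + by case: ifP => _ [x [Bx]]// /CA[].
  + by case: ifP => _ [x []]// /CA[].
  + by case: ifP => _; case: ifP => _ [x [Cx Dx]]//; apply: tC => //; exists x.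
- rewrite ltnS leq_eqVlt => /predU1P[->|ilt]; first by rewrite eqxx.
  by rewrite ltn_eqF// ilt; exact: Cw.
Qed.

(** The mass that [w] and the law of [K] have in common is left in place, and
    the rest of the space is cut into pieces which make up for the missing
    masses.  The pieces may leave out a null set, which is added to the fibre
    over [0]. *)
Lemma atomless_coupling (N : nat) (K : Omega -> nat) (w : nat -> R) :
  (forall i, measurable (K @^-1` [set i])) -> (forall x, (K x < N)%N) ->
  (forall i, 0 <= w i) -> \sum_(i < N) w i = 1 ->
  exists K' : Omega -> nat, [/\ forall i, measurable (K' @^-1` [set i]),
    forall x, (K' x < N)%N,
    forall i, (i < N)%N -> pr (K' @^-1` [set i]) = w i &
    exists A, [/\ measurable A, forall x, ~ A x -> K' x = K x &
      pr A <= \sum_(i < N) `|w i - pr (K @^-1` [set val i])|]].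
Proof.
move=> mK KN w0 w1.
pose v i := pr (K @^-1` [set i]).
have v0 i : 0 <= v i by exact: prb_ge0.
have /choice[B BP] i : exists B, [/\ measurable B, B `<=` K @^-1` [set i] &
    pr B = Num.min (v i) (w i)].
  by apply: atomless_intermediate => //; rewrite le_min v0 w0 ge_min lexx.
have mB i : measurable (B i) by case: (BP i).
have BK i x : B i x -> K x = i by case: (BP i) => _ + _; exact.
have prB i : pr (B i) = Num.min (v i) (w i) by case: (BP i).
have tB : trivIset setT B.
  by move=> i j _ _ [x [/BK <- /BK]].
pose U := \big[setU/set0]_(i < N) B i.
have mU : measurable U by exact: bigsetU_measurable.
have UB i x : B i x -> U x.
  move=> Bx; rewrite /U -bigcup_mkord; exists i => //=.
  by rewrite -(BK _ _ Bx).
have prU : pr (~` U) = \sum_(i < N) (w i - Num.min (v i) (w i)).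
  rewrite -setTD prbD// prbT prb_bigU// -w1 -sumrB.
  by apply: eq_bigr => i _; rewrite prB.
have [i||C [mC CU tC Cw]] := @atomless_split N
    (fun i => w i - Num.min (v i) (w i)) _ (measurableC mU).
- by rewrite subr_ge0 ge_min lexx orbT.
- by rewrite prU.
pose D i := B i `|` C i.
have mD i : measurable (D i) by exact: measurableU.
have tD : trivIset setT D.
  move=> i j _ _ [x [[Bix|Cix] [Bjx|Cjx]]].
  - by apply: tB => //; exists x.
  - by have := CU _ _ Cjx; case; exact: UB Bix.
  - by have := CU _ _ Cix; case; exact: UB Bjx.
  - by apply: tC => //; exists x.
pose K' x := xget 0%N [set i | (i < N)%N /\ D i x].
have K'D i x : (i < N)%N -> D i x -> K' x = i.
  move=> iN Dx; rewrite /K'; case: xgetP => [j _ [jN Dj]|/(_ i)]; last by case.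
  by apply: tD => //; exists x.
have K'N x : (K' x < N)%N.
  rewrite /K'; case: xgetP => [j _ []//|_].
  exact: leq_ltn_trans (KN x).
have mK' i : measurable (K' @^-1` [set i]).
  rewrite (_ : _ @^-1` _ = (if (i < N)%N then D i else set0) `|`
      (if i == 0%N then ~` \big[setU/set0]_(j < N) D j else set0)).
    apply: measurableU; first by case: ifP.
    by case: ifP => // _; apply: measurableC; exact: bigsetU_measurable.
  apply/seteqP; split => x /=; rewrite -bigcup_mkord.
    rewrite /K'; case: xgetP => [j -> [jN Dj] <-|nD <-]; first by left; rewrite jN.
    by right; rewrite eqxx => -[j jN Dj]; apply: (nD j).
  case.
    by case: ifP => // iN; exact: K'D.
  case: eqP => // -> nD; rewrite /K'; case: xgetP => // j _ [jN Dj].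
  by case: nD; exists j.
have prD i : (i < N)%N -> pr (D i) = w i.
  move=> iN; rewrite prbU//.
    by rewrite prB Cw// addrC subrK.
  apply/seteqP; split => // x [Bx /CU]; apply; exact: UB Bx.
have geK' i : (i < N)%N -> w i <= pr (K' @^-1` [set i]).
  move=> iN; rewrite -prD//; apply: le_prb => // x; exact: K'D.
exists K'; split => //.
- have sumK' : \sum_(i < N) (pr (K' @^-1` [set val i]) - w i) = 0.
    rewrite sumrB w1 -(@prb_bigU _ _ _ P N (fun i => K' @^-1` [set i]))//.
      rewrite (_ : \big[_/_]_(i < N) _ = setT) ?prbT ?subrr//.
      apply/seteqP; split => // x _; rewrite -(bigcup_mkord N (fun i => K' @^-1` [set i])).
      by exists (K' x) => //=; exact: K'N.
    by move=> i j _ _ [x [<- <-]].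
  move=> i iN; apply/eqP; rewrite -subr_eq0; apply/eqP.
  have /psumr_eq0P := sumK'.
  by move=> /(_ _ (Ordinal iN)); apply => // j _; rewrite subr_ge0 geK'.
- exists (~` U); split; first exact: measurableC.
    move=> x /contrapT; rewrite /U -bigcup_mkord => -[i iN Bx].
    by rewrite (BK _ _ Bx); apply: K'D => //; left.
  rewrite prU; apply: ler_sum => i _; rewrite -/(v i).
  have [_|_] := leP (v i) (w i); first exact: ler_norm.
  by rewrite subrr.
Qed.

End coupling.

(** * Continuity of convex monotone functionals on L^p *)

Section Lp_variables.
Context d {Omega : measurableType d} {R : realType} (P : probability Omega R).
Context (p : R) (p1 : (1 <= p%:E)%E).

Lemma exponent_gt0 : 0 < p.
Proof. by move: p1; rewrite lee_fin; exact: lt_le_trans. Qed.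

Lemma Lfun_powR (f : Omega -> R) : measurable_fun setT f ->
  (\int[P]_x (`|f x| `^ p)%:E < +oo)%E -> f \in Lfun P p%:E.
Proof.
move=> mf finf; apply/andP; split; rewrite inE//=.
rewrite /finite_norm unlock /Lnorm.
by apply: poweR_lty.
Qed.

Lemma Lfun_bounded (f : Omega -> R) (C : R) : measurable_fun setT f ->
  (forall x, `|f x| <= C) -> f \in Lfun P p%:E.
Proof.
move=> mf fC; apply: Lfun_powR => //.
apply: (@le_lt_trans _ _ (\int[P]_x (C `^ p)%:E)%E).
  apply: ge0_le_integral => //.
  - apply/measurable_EFinP; apply: (@measurableT_comp _ _ _ _ _ _ (@powR R ^~ p)).
      exact: measurable_powR.
    exact: measurableT_comp.
  - by move=> x _; rewrite lee_fin ge0_ler_powR ?nnegrE ?(le_trans _ (fC x))// ltW// exponent_gt0.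
by rewrite integral_cst//= probability_setT mule1 ltry.
Qed.

(** The witness is the [p]-th root of the sum of the [(k+1)^p 1_(A k)], whose
    integral is at most [1].  It provides the single direction into which a
    sequence of errors supported on the [A k] fits, after division by [k+1]. *)
Lemma Lfun_dominating (A : nat -> set Omega) :
  (forall k, measurable (A k)) ->
  (forall k, (k.+1%:R `^ p) * prb P (A k) <= 1 / (2 ^ k.+1)%:R) ->
  exists G : LfunType P p1, (forall x, 0 <= G x) /\
    forall k, {ae P, forall x, A k x -> k.+1%:R <= G x}.
Proof.
move=> mA PA.
have p0 := exponent_gt0.
pose f k x : \bar R := ((k.+1%:R `^ p) * \1_(A k) x)%:E.
have f0 k x : (0 <= f k x)%E by rewrite lee_fin mulr_ge0 ?powR_ge0.
have mf k : measurable_fun setT (f k).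
  by apply/measurable_EFinP; apply: measurable_funM => //; exact: measurable_indic.
pose S x := (\sum_(0 <= k <oo) f k x)%E.
have S0 x : (0 <= S x)%E by apply: nneseries_ge0 => k _ _; exact: f0.
have mS : measurable_fun setT S by apply: ge0_emeasurable_sum.
have intS : (\int[P]_x S x <= 1)%E.
  rewrite integral_nneseries//.
  apply: le_trans (epsilon_trick0 xpredT (@ler01 R)).
  apply: lee_nneseries => [k _ _|k _]; first exact: integral_ge0.
  rewrite /f; under eq_integral do rewrite EFinM.
  rewrite ge0_integralZl//; last first.
    by apply/measurable_EFinP; exact: measurable_indic.
  rewrite integral_indic// setIT.
  have := PA k; rewrite -lee_fin EFinM -prbE//.
have iS : P.-integrable setT S.
  apply/integrableP; split => //.
  under eq_integral do rewrite gee0_abs//.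
  by apply: le_lt_trans intS _; rewrite ltry.
pose G x := fine (S x) `^ p^-1.
have mfS : measurable_fun setT (fine \o S).
  exact: (measurableT_comp (@fine_measurable R setT measurableT)).
have mG : measurable_fun setT G.
  exact: (measurableT_comp (measurable_powR _)).
have GL : G \in Lfun P p%:E.
  apply: Lfun_powR => //.
  apply: (@le_lt_trans _ _ (\int[P]_x S x)%E); last by apply: le_lt_trans intS _; rewrite ltry.
  apply: ge0_le_integral => //.
  - apply/measurable_EFinP; apply: (@measurableT_comp _ _ _ _ _ _ (@powR R ^~ p)).
      exact: measurable_powR.
    exact: measurableT_comp.
  - move=> x _; rewrite ger0_norm ?powR_ge0// -powRrM mulVf ?gt_eqF// powRr1 ?fine_ge0//.
    by case: (S x) (S0 x) => //= r _; rewrite leey.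
exists (Lfun_Sub p1 GL); split => [x|k]; first exact: powR_ge0.
have := integrable_ae measurableT iS.
apply: filterS => x /(_ I) Sfin Ax; change (k.+1%:R <= G x).
have kS : k.+1%:R `^ p <= fine (S x).
  rewrite -lee_fin fineK//.
  have -> : (k.+1%:R `^ p)%:E = f k x by rewrite /f indicE mem_set// mulr1.
  rewrite /S (@nneseriesD1 _ _ k)// leeDl// nneseries_ge0//.
apply: (@le_trans _ _ ((k.+1%:R `^ p) `^ p^-1)).
  by rewrite -powRrM mulfV ?gt_eqF// powRr1.
by rewrite /G ge0_ler_powR ?nnegrE ?powR_ge0 ?fine_ge0 ?invr_ge0 ?(ltW p0)//.
Qed.

End Lp_variables.

Section risk_continuity.
Context d {Omega : measurableType d} {R : realType} (P : probability Omega R).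
Context (p : R) (p1 : (1 <= p%:E)%E) (rho : LfunType P p1 -> R).
Hypotheses (rho_convex : risk_convex rho) (rho_mono : risk_nondecreasing rho).

(** Convexity on the segment from [Z0] to [Z0 + G] gives the upper bound; the
    lower one is convexity on the segment from [Z] to [Z0 + G], whose point
    with weights proportional to [1] and [a] lies above [Z0] almost surely. *)
Lemma risk_local_lipschitz (Z0 Z G : LfunType P p1) (a : R) : 0 < a <= 1 ->
  {ae P, forall x, `|Z x - Z0 x| <= a * G x} ->
  `|rho Z - rho Z0| <= a * (rho (Z0 + G) - rho Z0).
Proof.
move=> /andP[a0 a1] ZG.
have up : rho Z <= a * rho (Z0 + G) + (1 - a) * rho Z0.
  apply: (@le_trans _ _ (rho (a *: (Z0 + G) + (1 - a) *: Z0))).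
    apply: rho_mono; apply: filterS ZG => x.
    rewrite ler_norml => /andP[_].
    change ((a *: (Z0 + G) + (1 - a) *: Z0) x) with (a * (Z0 x + G x) + (1 - a) * Z0 x).
    lra.
  by apply: rho_convex; rewrite ltW.
pose t := (1 + a)^-1.
have a10 : 0 < 1 + a by lra.
have ta : t * (1 + a) = 1 by rewrite mulVf// gt_eqF.
have e1 : 1 - t = t * a by rewrite -{1}ta mulrDr mulr1 addrC addKr.
have t0 : 0 < t by rewrite invr_gt0.
have t1 : t <= 1 by nra.
have lo : rho Z0 <= t * rho Z + (1 - t) * rho (Z0 + G).
  apply: (@le_trans _ _ (rho (t *: Z + (1 - t) *: (Z0 + G)))).
    apply: rho_mono; apply: filterS ZG => x.
    rewrite ler_norml => /andP[+ _].
    change ((t *: Z + (1 - t) *: (Z0 + G)) x) with (t * Z x + (1 - t) * (Z0 x + G x)).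
    move=> h; rewrite e1.
    have -> : t * Z x + t * a * (Z0 x + G x) = t * (Z x + a * (Z0 x + G x)).
      by ring.
    have -> : Z0 x <= t * (Z x + a * (Z0 x + G x)) =
        (t * ((1 + a) * Z0 x) <= t * (Z x + a * (Z0 x + G x))).
      by rewrite [in RHS]mulrA ta mul1r.
    by rewrite ler_pM2l//; lra.
  by apply: rho_convex; rewrite ltW.
rewrite e1 in lo.
rewrite ler_norml; apply/andP; split; last lra.
have : (1 + a) * rho Z0 <= (1 + a) * (t * rho Z + t * a * rho (Z0 + G)).
  by rewrite ler_pM2l.
have -> : (1 + a) * (t * rho Z + t * a * rho (Z0 + G)) =
   (t * (1 + a)) * (rho Z + a * rho (Z0 + G)) by ring.
rewrite ta; lra.
Qed.

(** Were this false, there would be violating variables [Z k] with exceptional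
    sets [A k] so small that all the errors [Z k - Z0] are dominated by
    [G / (k+1)] for one [p]-integrable [G]; then [risk_local_lipschitz] applies
    with [a = 1 / (k+1)]. *)
Lemma risk_continuous_in_probability (Z0 : LfunType P p1) (h e : R) :
  0 <= h -> 0 < e ->
  exists2 del : R, 0 < del & forall (Z : LfunType P p1) (A : set Omega),
    measurable A -> prb P A <= del ->
    (forall x, ~ A x -> `|Z x - Z0 x| <= del) ->
    (forall x, `|Z x - Z0 x| <= h) ->
    `|rho Z - rho Z0| < e.
Proof.
move=> h0 e0; apply: contrapT => nex.
(* The first bound makes the error off [A k] small, the second one meets the
   summability requirement of [Lfun_dominating]. *)
pose del k : R := Num.min k.+1%:R^-1 (1 / (2 ^ k.+1)%:R / (k.+1%:R `^ p)).
have pw0 k : 0 < k.+1%:R `^ p by rewrite powR_gt0.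
have p2 k : 0 < (2 ^ k.+1)%:R :> R by rewrite ltr0n expn_gt0.
have del0 k : 0 < del k.
  by rewrite lt_min invr_gt0 ltr0Sn/= !divr_gt0.
have /choice[ZA bad] k : exists ZA : LfunType P p1 * set Omega,
    [/\ measurable ZA.2, prb P ZA.2 <= del k,
     forall x, ~ ZA.2 x -> `|ZA.1 x - Z0 x| <= del k,
     forall x, `|ZA.1 x - Z0 x| <= h & e <= `|rho ZA.1 - rho Z0|].
  apply: contrapT => nk; apply: nex; exists (del k) => // Z A mA PA ZA Zh.
  by rewrite ltNge; apply/negP => le; apply: nk; exists (Z, A); split.
pose A k := (ZA k).2; pose Z k := (ZA k).1.
have [||G [G0 GA]] := @Lfun_dominating _ _ _ P p p1 A.
- by move=> k; have [] := bad k.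
- move=> k; have [_ + _ _ _] := bad k; rewrite -/(A k) le_min => /andP[_].
  by rewrite ler_pdivlMr// mulrC.
have one_bdd : cst 1 \in Lfun P p%:E by apply: (@Lfun_bounded _ _ _ _ _ p1 _ `|1|).
pose H := h *: G + Lfun_Sub p1 one_bdd.
have HE x : H x = h * G x + 1 by [].
have bound k : e <= k.+1%:R^-1 * (rho (Z0 + H) - rho Z0).
  have [mA PA Zd Zh eZ] := bad k; apply: le_trans eZ _.
  have k0 : 0 < k.+1%:R^-1 :> R by rewrite invr_gt0.
  apply: risk_local_lipschitz; first by rewrite k0 invf_le1// ler1n.
  apply: filterS (GA k) => x GAx; rewrite HE.
  rewrite mulrC ler_pdivlMr ?ltr0Sn//.
  have [Ax|nAx] := pselect (A k x).
    apply: (@le_trans _ _ (h * G x)); last by rewrite lerDl.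
    by apply: ler_pM => //; exact: GAx.
  have : `|(ZA k).1 x - Z0 x| <= k.+1%:R^-1.
    by apply: le_trans (Zd x nAx) _; rewrite ge_min lexx.
  rewrite -ler_pdivlMr ?ltr0Sn// => /le_trans; apply.
  rewrite ler_pdivlMr ?ltr0Sn// mulVf// lerDr mulr_ge0//.
pose c := rho (Z0 + H) - rho Z0.
have c0 : 0 < c.
  by have := bound 0%N; rewrite invr1 mul1r -/c; exact: lt_le_trans.
pose n := Num.bound (c / e).
have : c / e < n%:R by apply: archi_boundP; rewrite divr_ge0// ltW.
rewrite ltr_pdivrMr// => cn.
have := bound n; rewrite mulrC ler_pdivlMr// -/c.
rewrite -natr1 mulrC mulrDl mul1r; lra.
Qed.

End risk_continuity.

(** * Borel probability measures on R^k *)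

Section borel_Rn.
Context {R : realType} {k : nat}.

Lemma borel_open (U : set 'cV[R]_k) : open U -> measurable (U : set (borelRn R k)).
Proof. by move=> oU; exact: sub_sigma_algebra. Qed.

Lemma borel_continuous (h : 'cV[R]_k -> R) :
  continuous h -> measurable_fun setT (h : borelRn R k -> R).
Proof.
move=> ch; apply: (measurability _ (RGenOInfty.measurableE R)).
move=> _ [_ [a ->]] <-; rewrite setTI; apply: borel_open.
by move/continuousP : ch; apply; exact: interval_open.
Qed.

Lemma borel_coord (i : 'I_k) :
  measurable_fun setT (fun z : borelRn R k => (z : 'cV[R]_k) i ord0).
Proof. by apply: borel_continuous => z; exact: coord_continuous. Qed.

Lemma measurable_forall_le d (S : measurableType d) (I : finType)
  (f g : I -> S -> R) :
  (forall i, measurable_fun setT (f i)) -> (forall i, measurable_fun setT (g i)) ->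
  measurable [set x | forall i, f i x <= g i x].
Proof.
move=> mf mg.
rewrite (_ : [set x | _] = \bigcap_(i in setT) [set x | f i x <= g i x]); last first.
  by apply/seteqP; split => x /= h => [i _|i]; [exact: h|exact: h].
apply: fin_bigcap_measurable; first exact: finite_finset.
move=> i _; rewrite -[X in measurable X]setTI.
exact: measurable_fun_le.
Qed.

Lemma measurable_box (a b : 'cV[R]_k) :
  measurable ([set x | lev a x /\ lev x b] : set (borelRn R k)).
Proof.
apply: measurableI; apply: measurable_forall_le => i //; exact: borel_coord.
Qed.

(** Balls with rational centre and radius [1 / (N+1)] form a countable base, so
    the null open sets that make up the complement of the support can be
    replaced by countably many null balls. *)
Lemma support_ae (mu : probability (borelRn R k) R) : {ae mu, forall z, Defs.support mu z}.
Proof.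
pose B (c : 'cV[rat]_k * nat) : set 'cV[R]_k :=
  ball (map_mx ratr c.1 : 'cV[R]_k) (c.2.+1%:R^-1 : R).
pose F n : set (borelRn R k) :=
  if unpickle n is Some c then if mu (B c) == 0%E then B c else set0 else set0.
have nF n : mu.-negligible (F n).
  rewrite /F; case: unpickle => [c|]; last exact: negligible_set0.
  case: eqP => [Bc|_]; last exact: negligible_set0.
  by apply/negligibleP => //; apply: borel_open; exact: ball_open.
apply: negligibleS (negligible_bigcup nF) => z /= /existsNP[U] /not_implyP[oU].
move=> /not_implyP[Uz /negP]; rewrite -leNgt => muU.
have [r /= r0 rU] : exists2 r : R, 0 < r & ball z r `<=` U.
  by apply/nbhs_ballP; exact: open_nbhs_nbhs.
pose N := Num.bound (2 / r).
have N0 : 0 < N.+1%:R^-1 :> R by rewrite invr_gt0.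
have Nr : N.+1%:R^-1 + N.+1%:R^-1 <= r.
  have : 2 / r < N.+1%:R.
    apply: (@lt_trans _ _ N%:R); last by rewrite ltr_nat.
    by apply: archi_boundP; rewrite divr_ge0// ltW.
  by rewrite ltr_pdivrMr// -ltr_pdivrMl// => /ltW; rewrite mulr_natr mulr2n.
have /choice[q qP] i : exists q : rat, `|ratr q - z i ord0| < N.+1%:R^-1.
  have [|q] := @rat_in_itvoo R (z i ord0 - N.+1%:R^-1) (z i ord0 + N.+1%:R^-1).
    by rewrite ltrBlDr -addrA ltrDl addr_gt0.
  by rewrite in_itv/= => /andP[q1 q2]; exists q; rewrite ltr_norml ltrBrDl q1 ltrBlDl.
pose c := (\col_i q i, N).
have zc : ball (map_mx ratr c.1 : 'cV[R]_k) (N.+1%:R^-1 : R) z.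
  split => // i j; rewrite !mxE (ord1 j).
  exact: qP.
exists (pickle c) => //; rewrite /F pickleK.
have Bc : B c `<=` U.
  move=> y By; apply: rU; apply: le_ball Nr _ _.
  by apply: ball_triangle By; exact: ball_sym.
have -> : mu (B c) == 0%E.
  rewrite eq_le measure_ge0 andbT; apply: le_trans muU.
  by apply: le_measure; rewrite ?inE//; apply: borel_open => //; exact: ball_open.
exact: zc.
Qed.

(** A hyperplane is a countable union of boxes with an edge of length zero. *)
Lemma density_hyperplane (mu : probability (borelRn R k) R) (i : 'I_k) (a : R) :
  bounded_lebesgue_density mu ->
  mu ([set z | z i ord0 = a] : set 'cV[R]_k) = 0%E.
Proof.
move=> [lam lamE [g [C [mg g0 muE]]]].
set H := (X in mu X).
have mH : measurable (H : set (borelRn R k)).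
  rewrite (_ : H = setT `&` ((fun z : borelRn R k => (z : 'cV[R]_k) i ord0) @^-1` [set a])).
    exact: borel_coord.
  by rewrite setTI.
pose lo (n : nat) : 'cV[R]_k := \col_j if j == i then a else - n%:R.
pose up (n : nat) : 'cV[R]_k := \col_j if j == i then a else n%:R.
have H0 : lam H = 0%E.
  apply/negligibleP => //.
  pose F n := [set x : 'cV[R]_k | lev (lo n) x /\ lev x (up n)].
  apply: (@negligibleS _ _ _ _ (\bigcup_n (F n : set (borelRn R k)))); last first.
    apply: negligible_bigcup => n; apply/negligibleP; first exact: measurable_box.
    have up_lo : lev (lo n) (up n).
      by move=> j; rewrite !mxE; case: ifP => // _; rewrite ge0_cp.
    apply: etrans (lamE _ _ up_lo) _.
    by rewrite (bigD1 i)//= !mxE eqxx subrr mul0r.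
  move=> z; rewrite /H/= => za.
  exists (Num.bound (\sum_j `|z j ord0|)) => //.
  have zb j : `|z j ord0| <= (Num.bound (\sum_j `|z j ord0|))%:R.
    apply: ltW; apply: (@le_lt_trans _ _ (\sum_j `|z j ord0|)).
      by rewrite (bigD1 j)//= lerDl sumr_ge0.
    by apply: archi_boundP; exact: sumr_ge0.
  split => j; rewrite !mxE; case: eqP => [->|_]; rewrite ?za//.
    by have := zb j; rewrite ler_norml => /andP[].
  by have := zb j; rewrite ler_norml => /andP[].
rewrite muE//; apply: null_set_integral => //.
by apply/measurable_EFinP; apply: measurable_funTS.
Qed.

End borel_Rn.

(** * Cells cut out by coordinate hyperplanes *)

Section gaps.
Context {R : realType} {k : nat}.
Implicit Types (L : seq ('I_k * R)) (t : 'cV[R]_k) (E : set 'cV[R]_k) (del : R).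

(** The finitely many hyperplanes [t_i = v] with [(i, v)] in [L] cut the space
    into cells; the determined sets are the unions of such cells. *)
Definition determined L E := forall t t',
  (forall l, l \in L -> (l.2 <= t l.1 ord0) = (l.2 <= t' l.1 ord0)) -> E t -> E t'.

(** Induction on [L]: on either side of its first hyperplane, [E] coincides with
    a set that is determined by the others. *)
Lemma determined_measurable d (S : measurableType d) (f : S -> 'cV[R]_k) L E :
  (forall i, measurable_fun setT (fun x => f x i ord0)) ->
  determined L E -> measurable (f @^-1` E).
Proof.
move=> mf; elim: L E => [|[i v] L ih] E detE.
  have [[t Et]|nE] := pselect (E !=set0).
    by rewrite (_ : _ @^-1` _ = setT)//; apply/seteqP; split => // x _; exact: detE Et.
  by rewrite (_ : _ @^-1` _ = set0)//; apply/seteqP; split => // x Ex; case: nE; exists (f x).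
pose C : set S := [set x | v <= f x i ord0].
have mC : measurable C.
  rewrite -[C]setTI; apply: measurable_fun_le => //.
pose part (b : bool) : set 'cV[R]_k := [set t | exists t', [/\ E t',
  (v <= t' i ord0) = b &
  forall l, l \in L -> (l.2 <= t' l.1 ord0) = (l.2 <= t l.1 ord0)]].
have det_part b : determined L (part b).
  move=> t t' tt' [u [Eu ub ut]]; exists u; split => // l lL.
  by rewrite ut// tt'.
have inE_part x b : (v <= f x i ord0) = b -> E (f x) <-> part b (f x).
  move=> xb; split => [Ex|[u [Eu ub ux]]]; first by exists (f x).
  apply: detE Eu => l; rewrite inE => /predU1P[->/=|]; first by rewrite ub xb.
  exact: ux.
rewrite (_ : _ @^-1` _ = (C `&` f @^-1` part true) `|` (~` C `&` f @^-1` part false)).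
  apply: measurableU; apply: measurableI; [exact: mC|exact: ih|
    exact: measurableC|exact: ih].
apply/seteqP; split => x /=.
  move=> Ex; case: (boolP (v <= f x i ord0)) => xv.
    by left; split => //; apply/(inE_part x true).
  by right; split; [exact/negP|apply/(inE_part x false) => //; exact/negbTE].
case=> -[xv]; first by move/(inE_part x true); exact.
by move/(inE_part x false); apply; apply/negbTE/negP.
Qed.

(** The distance to the union of the hyperplanes, capped at [1] so that it is
    also meaningful for empty [L]. *)
Definition gap L t : R := \big[Num.min/1]_(l <- L) `|l.2 - t l.1 ord0|.

Lemma gap_ge0 L t : 0 <= gap L t.
Proof.
rewrite /gap; elim: L => [|l L ih]; rewrite ?big_nil// big_cons.
by rewrite le_min ih normr_ge0.
Qed.

Lemma gap_le L t l : l \in L -> gap L t <= `|l.2 - t l.1 ord0|.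
Proof.
rewrite /gap; elim: L => [//|l' L ih]; rewrite inE big_cons => /predU1P[->|/ih le].
  by rewrite ge_min lexx.
by rewrite ge_min le orbT.
Qed.

Lemma gap_eq0 L t : gap L t = 0 -> exists2 l, l \in L & t l.1 ord0 = l.2.
Proof.
rewrite /gap; elim: L => [|l L ih]; first by rewrite big_nil => /eqP; rewrite oner_eq0.
rewrite big_cons; case: leP => _.
  by move/normr0_eq0/eqP; rewrite subr_eq0 => /eqP lt; exists l; rewrite ?mem_head.
by move/ih => [l' l'L tl']; exists l' => //; rewrite inE l'L orbT.
Qed.

Lemma gap_lipschitz L t t' (c : R) : 0 <= c ->
  (forall i, `|t i ord0 - t' i ord0| <= c) -> gap L t <= gap L t' + c.
Proof.
move=> c0 tt'; rewrite /gap; elim: L => [|l L ih]; first by rewrite !big_nil lerDl.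
rewrite !big_cons addr_minl le_min !ge_min ih orbT andbT; apply/orP; left.
have := tt' l.1; rewrite distrC => le.
by apply: le_trans (ler_distD (t' l.1 ord0) _ _) _; rewrite lerD2l.
Qed.

(** A move by less than the distance to the walls crosses none of them. *)
Lemma gap_determined L E t t' : determined L E ->
  (forall i, `|t i ord0 - t' i ord0| < gap L t) -> E t <-> E t'.
Proof.
move=> detE tt'.
have same l : l \in L -> (l.2 <= t l.1 ord0) = (l.2 <= t' l.1 ord0).
  move=> lL; have := lt_le_trans (tt' l.1) (gap_le t lL).
  have [h|h] := lerP l.2 (t l.1 ord0); have [h'|h'] := lerP l.2 (t' l.1 ord0) => //.
    move=> /(le_lt_trans (ler_norm _)); lra.
  rewrite distrC => /(le_lt_trans (ler_norm _)); lra.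
by split; apply: detE => l lL; rewrite same.
Qed.

Definition cutoff L (del : R) t : R := Num.min 1 (gap L t / del).

Lemma cutoff_ge0 L del t : 0 < del -> 0 <= cutoff L del t.
Proof. by move=> d0; rewrite /cutoff le_min ler01 divr_ge0 ?gap_ge0// ltW. Qed.

Lemma cutoff_le1 L del t : cutoff L del t <= 1.
Proof. by rewrite /cutoff ge_min lexx. Qed.

Lemma cutoff_lipschitz L del t t' (c : R) : 0 < del -> 0 <= c ->
  (forall i, `|t i ord0 - t' i ord0| <= c) ->
  `|cutoff L del t - cutoff L del t'| <= c / del.
Proof.
move=> d0 c0 tt'.
have half (u u' : 'cV[R]_k) : (forall i, `|u i ord0 - u' i ord0| <= c) ->
    cutoff L del u <= cutoff L del u' + c / del.
  move=> uu'; rewrite /cutoff addr_minl le_min !ge_min -mulrDl.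
  rewrite ler_pM2r ?invr_gt0// gap_lipschitz// orbT andbT.
  by rewrite lerDl divr_ge0// ltW.
rewrite ler_distl; apply/andP; split; last exact: half.
by rewrite lerBlDr; apply: half => i; rewrite distrC.
Qed.

Definition smooth_indic L del E t : R := cutoff L del t * \1_E t.

(** The jumps of the indicator of [E] are all on the hyperplanes, where [cutoff]
    vanishes.  If [t] and [t'] lie on different sides of a jump, both are within
    [c] of a wall, and [cutoff] is at most [c / del] at both of them. *)
Lemma smooth_indic_lipschitz L del E t t' (c : R) : determined L E ->
  0 < del -> 0 <= c -> (forall i, `|t i ord0 - t' i ord0| <= c) ->
  `|smooth_indic L del E t - smooth_indic L del E t'| <= c / del.
Proof.
move=> detE d0 c0 tt'; rewrite /smooth_indic.
have c'0 u := cutoff_ge0 L u d0.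
have small (u u' : 'cV[R]_k) : (forall i, `|u i ord0 - u' i ord0| <= c) -> ~ (E u <-> E u') ->
    cutoff L del u <= c / del.
  move=> uu' nE; rewrite /cutoff ge_min; apply/orP; right.
  rewrite ler_pM2r ?invr_gt0// leNgt; apply/negP => cg; apply: nE.
  by apply: (gap_determined detE) => i; exact: le_lt_trans (uu' i) cg.
have [Et|nEt] := pselect (E t); have [Et'|nEt'] := pselect (E t').
- by rewrite !indicE !mem_set// !mulr1; exact: cutoff_lipschitz.
- rewrite !indicE mem_set// memNset// mulr1 mulr0 subr0 ger0_norm//.
  by apply: small tt' _ => -[/(_ Et)].
- rewrite !indicE memNset// mem_set// mulr1 mulr0 sub0r normrN ger0_norm//.
  apply: (@small t' t) => [i|]; first by rewrite distrC.
  by move=> [/(_ Et')].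
- by rewrite !indicE !memNset// !mulr0 subrr normr0 divr_ge0// ltW.
Qed.

(** Either [t] is at least [del / 2] away from the walls, and then [t'] is on the
    same side of all of them, or [cutoff L del t] is at most [1/2], which makes
    the right-hand side at least [1]. *)
Lemma smooth_indic_near L del E t t' : determined L E -> 0 < del ->
  (forall i, `|t i ord0 - t' i ord0| < del / 2) ->
  `|\1_E t' - smooth_indic L del E t| <= 2 * (1 - cutoff L del t).
Proof.
move=> detE d0 tt'.
have c0 := cutoff_ge0 L t d0; have c1 := cutoff_le1 L del t.
have i01 u : 0 <= (\1_E u : R) <= 1.
  by rewrite indicE; case: (_ \in _); rewrite ?lexx ler01.
have := i01 t; have := i01 t'; rewrite /smooth_indic.
have [g2|gd] := ltP (gap L t) (del / 2).
  have c2 : cutoff L del t <= 2^-1.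
    rewrite /cutoff ge_min; apply/orP; right.
    by rewrite ler_pdivrMr// mulrC ltW.
  move: (\1_E t : R) (\1_E t' : R) => x y /andP[y0 y1] /andP[x0 x1].
  rewrite ler_distl; apply/andP; split; nra.
have -> : (\1_E t' : R) = \1_E t.
  rewrite !indicE; congr (nat_of_bool _)%:R; apply/idP/idP; rewrite !inE;
  have [EE EE'] := gap_determined detE (fun i => lt_le_trans (tt' i) gd).
    exact: EE'.
  exact: EE.
move: (\1_E t : R) => x _ /andP[x0 x1].
rewrite ler_distl; apply/andP; split; nra.
Qed.

End gaps.

(** * Weak continuity of cell masses *)

Section weak_continuity.
Context {R : realType} {k : nat}.
Implicit Types (mu nu : probability (borelRn R k) R).

Definition expect nu (h : 'cV[R]_k -> R) : R := \int[nu]_z (h z : R).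

Lemma lipschitz_continuous (h : 'cV[R]_k -> R) (C : R) : 0 <= C ->
  (forall (z z' : 'cV[R]_k) (c : R), 0 <= c -> (forall i, `|z i ord0 - z' i ord0| <= c) ->
    `|h z - h z'| <= c * C) -> continuous h.
Proof.
move=> C0 lip z; apply/(@cvgrPdist_lt _ _ _ (nbhs z)) => e e0.
have d0 : 0 < e / (C + 1) by rewrite divr_gt0// ltr_wpDl.
near=> z'.
have zz' : ball z (e / (C + 1)) z' by near: z'; exact: nbhsx_ballx.
apply: (@le_lt_trans _ _ (e / (C + 1) * C)).
  apply: lip; first exact: ltW.
  by move=> i; apply: ltW; case: zz' => _ /(_ i ord0).
by rewrite -mulrA gtr_pMr// mulrC ltr_pdivrMr ?mul1r ?ltrDl// ltr_wpDl.
Unshelve. all: by end_near. Qed.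

Lemma weak_near mu (h : 'cV[R]_k -> R) (e : R) : bounded_continuous h -> 0 < e ->
  \forall nu \near (mu : probRn R k), `|expect mu h - expect nu h| < e.
Proof.
move=> bh e0.
have cont : {for (mu : probRn R k), continuous (expect^~ h : probRn R k -> R)}.
  pose H := exist (fun h => bounded_continuous h) h bh.
  apply: (@continuous_comp _ _ _ (@expectations R k : probRn R k -> _)
    (fun f : {ptws {h | bounded_continuous h} -> R} => f H)).
    exact: initial_continuous.
  exact: (@proj_continuous {classic {h | bounded_continuous h}} (fun=> R) H).
by move/cvgrPdist_lt : cont; exact.
Qed.

Lemma bounded_integrable nu (h : borelRn R k -> R) (C : R) :
  measurable_fun setT h -> (forall z, `|h z| <= C) ->
  nu.-integrable setT (EFin \o h).
Proof.
move=> mh hC; apply: measurable_bounded_integrable => //.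
  by rewrite (le_lt_trans (probability_le1 _ _))// ltry.
exists C; split; first exact: num_real.
by move=> y Cy z _; exact: le_trans (hC z) (ltW Cy).
Qed.

Definition shifted_mass nu (E : set 'cV[R]_k) (b : 'cV[R]_k) : R :=
  prb nu ([set z | E (b + z)] : set 'cV[R]_k).

(** Portmanteau for a cell complex whose walls are [mu]-null, with a
    simultaneous perturbation of the translation vector: off a [del]-neighbourhood
    of the walls, neither the perturbation nor the factor [cutoff] changes the
    indicator of [E], and the mass of that neighbourhood is controlled by the
    integral of the continuous function [1 - cutoff]. *)
Lemma weak_cell_continuous mu (L : seq ('I_k * R)) (E : set 'cV[R]_k)
    (b : 'cV[R]_k) (e : R) :
  determined L E ->
  (forall i a, mu ([set z | z i ord0 = a] : set 'cV[R]_k) = 0%E) -> 0 < e ->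
  exists2 del : R, 0 < del & \forall nu \near (mu : probRn R k), forall b' : 'cV[R]_k,
    (forall i, `|b' i ord0 - b i ord0| < del) ->
    `|shifted_mass nu E b' - shifted_mass mu E b| < e.
Proof.
move=> detE null e0.
have mcoord c i : measurable_fun setT (fun z : borelRn R k => (c + z : 'cV[R]_k) i ord0).
  apply: eq_measurable_fun (measurable_funD (@measurable_cst _ _ _ _ _ (c i ord0))
    (borel_coord i)) => z _.
  by rewrite mxE.
have mgap : measurable_fun setT (fun z : borelRn R k => gap L (b + z)).
  apply: borel_continuous; apply: (@lipschitz_continuous _ 1) => // z z' c c0 zz'.
  have h (u u' : 'cV[R]_k) : (forall i, `|u i ord0 - u' i ord0| <= c) ->
      gap L (b + u) <= gap L (b + u') + c.
    by move=> uu'; apply: gap_lipschitz => // i; rewrite !mxE opprD addrACA subrr add0r.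
  rewrite mulr1 ler_distl; apply/andP; split; last exact: h.
  by rewrite lerBlDr; apply: h => i; rewrite distrC.
pose F n : set (borelRn R k) := [set z | gap L (b + z) < n.+1%:R^-1].
have mF n : measurable (F n).
  rewrite (_ : F n = ~` (setT `&` [set z | n.+1%:R^-1 <= gap L (b + z)])).
    by apply: measurableC; exact: measurable_fun_le.
  by rewrite setTI; apply/seteqP; split => z; rewrite /F/= ltNge => /negP.
have mFI : measurable (\bigcap_n F n) by exact: bigcap_measurable.
have F0 : mu (\bigcap_n F n) = 0%E.
  apply/negligibleP => //.
  pose wall (l : 'I_k * R) : set (borelRn R k) :=
    [set z : 'cV[R]_k | z l.1 ord0 = l.2 - b l.1 ord0].
  apply: (@negligibleS _ _ _ _ (\bigcup_(l in [set` L]) wall l)).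
    move=> z Fz.
    have [|l lL bz] := @gap_eq0 _ _ L (b + z).
      apply/eqP; rewrite eq_le gap_ge0 andbT leNgt; apply/negP => g0.
      pose n := Num.bound (gap L (b + z))^-1.
      have := Fz n I; rewrite /F/= -[ltLHS]invrK ltf_pV2 ?posrE ?invr_gt0//.
      apply/negP; rewrite -leNgt ltW// (@lt_trans _ _ n%:R) ?ltr_nat//.
      by apply: archi_boundP; rewrite invr_ge0 gap_ge0.
    exists l; first exact: lL.
    by change (z l.1 ord0 = l.2 - b l.1 ord0); rewrite -bz mxE addrAC subrr add0r.
  rewrite bigcup_seq; elim/big_ind : _ => [||l _].
  - exact: negligible_set0.
  - by move=> A B; exact: negligibleU.
  - apply/negligibleP; last exact: null.
    rewrite -[X in measurable X]setTI.
    by have := borel_coord l.1 measurableT (measurable_set1 (l.2 - b l.1 ord0)).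
have [n Fn] : exists n, prb mu (F n) < e / 8.
  have cv : (mu \o F) n @[n --> \oo] --> mu (\bigcap_n F n).
    apply: nonincreasing_cvg_mu => //.
      by rewrite (le_lt_trans (probability_le1 _ _))// ltry.
    move=> i j ij; rewrite subsetEset => z /lt_le_trans; apply.
    by rewrite lef_pV2 ?posrE ?ltr0Sn// ler_nat.
  rewrite F0 in cv; move/fine_cvgP : cv => [_ /cvgrPdist_lt /(_ (e / 8))].
  rewrite divr_gt0// => /(_ isT) [n _ /(_ n (leqnn n))/=].
  rewrite sub0r normrN => h; exists n; exact: le_lt_trans (ler_norm _) h.
pose del : R := n.+1%:R^-1.
have del0 : 0 < del by rewrite invr_gt0.
exists (del / 2); first by rewrite divr_gt0.
pose j z := cutoff L del (b + z); pose h z := smooth_indic L del E (b + z).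
have j0 z : 0 <= j z by exact: cutoff_ge0.
have j1 z : j z <= 1 by exact: cutoff_le1.
have h01 z : `|h z| <= 1.
  rewrite /h /smooth_indic indicE ger0_norm ?mulr_ge0 ?cutoff_ge0//.
  by case: (_ \in _); rewrite ?mulr1 ?mulr0// cutoff_le1.
have cj : continuous j.
  apply: (@lipschitz_continuous _ del^-1) => [|z z' c c0 zz']; first by rewrite invr_ge0 ltW.
  by apply: cutoff_lipschitz => // i; rewrite !mxE opprD addrACA subrr add0r.
have ch : continuous h.
  apply: (@lipschitz_continuous _ del^-1) => [|z z' c c0 zz']; first by rewrite invr_ge0 ltW.
  by apply: smooth_indic_lipschitz => // i; rewrite !mxE opprD addrACA subrr add0r.
have jn z : `|j z| <= 1 by rewrite ger0_norm.
have mj := borel_continuous cj; have mh := borel_continuous ch.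
have ij nu := bounded_integrable nu mj jn.
have ih nu := bounded_integrable nu mh h01.
have e8 : 0 < e / 8 by rewrite divr_gt0.
have mE c : measurable ([set z | E (c + z)] : set (borelRn R k)).
  by apply: (determined_measurable (f := fun z : borelRn R k => c + z : 'cV[R]_k)) detE.
have prbI nu (A : set (borelRn R k)) : measurable A -> prb nu A = expect nu \1_A.
  by move=> mA; rewrite /prb /expect /Rintegral integral_indic// setIT.
have iI nu (A : set (borelRn R k)) : measurable A ->
    nu.-integrable setT (EFin \o (\1_A : _ -> R)).
  move=> mA; apply: (@bounded_integrable _ _ 1); first exact: measurable_indic.
  by move=> z; rewrite indicE; case: (_ \in _); rewrite ?normr1 ?normr0.
have one_int nu : nu.-integrable setT (EFin \o cst (1:R)).
  by apply: (@bounded_integrable _ _ 1) => // z; rewrite normr1.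
have iq nu : nu.-integrable setT
    (EFin \o (fun z => 2 * (1 - j z))).
  apply: (@bounded_integrable _ _ 2).
    by apply: measurable_funM => //; apply: measurable_funB.
  by move=> z; rewrite ger0_norm ?mulr_ge0 ?subr_ge0//; have := j0 z; lra.
(* The one estimate that is used both for [nu] with the perturbed vector and for
   [mu] with [b] itself. *)
have near_h nu (b' : 'cV[R]_k) : (forall i, `|b' i ord0 - b i ord0| < del / 2) ->
    `|shifted_mass nu E b' - expect nu h| <= 2 * (1 - expect nu j).
  move=> bb'; rewrite /shifted_mass prbI// -(RintegralB measurableT (iI nu _ (mE b')) (ih nu)).
  apply: le_trans (le_normr_Rintegral _ _) _ => //.
    by have := integrableB measurableT (iI nu _ (mE b')) (ih nu).
  apply: (@le_trans _ _ (expect nu (fun z => 2 * (1 - j z)))).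
    apply: (le_Rintegral measurableT _ (iq nu)).
      by apply: integrable_norm; have := integrableB measurableT (iI nu _ (mE b')) (ih nu).
    move=> z _; have -> : (\1_[set z | E (b' + z)] z : R) = \1_E (b' + z).
      by rewrite !indicE; congr (nat_of_bool _)%:R; apply/idP/idP; rewrite !inE.
    apply: smooth_indic_near => // i.
    by rewrite !mxE opprD addrACA subrr addr0 distrC.
  rewrite /expect RintegralZl//; last first.
    by have := integrableB measurableT (one_int nu) (ij nu).
  rewrite (RintegralB measurableT (one_int nu) (ij nu)) Rintegral_cst//.
  by rewrite mul1r -/(prb nu setT) prbT.
have jmu : 1 - expect mu j <= e / 8.
  rewrite lerBlDr -lerBlDl.
  apply: le_trans (_ : prb mu (~` F n) <= _).
    by rewrite -setTD prbD// prbT lerD2l lerN2 ltW.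
  rewrite (prbI _ _ (measurableC (mF n))).
  apply: (le_Rintegral measurableT (iI _ _ (measurableC (mF n))) (ij mu)).
  move=> z _; rewrite indicE; case: (boolP (z \in _)) => [|_]; last exact: j0.
  rewrite inE /F/= => /negP; rewrite -leNgt => gz.
  by rewrite /j /cutoff le_min lexx ler_pdivlMr// mul1r.
have bch : bounded_continuous h by split => //; exists 1.
have bcj : bounded_continuous j by split => //; exists 1.
apply: (@filterS2 _ _ (nbhs_filter (mu : probRn R k)) _ _ _ _
  (weak_near mu bch e8) (weak_near mu bcj e8)) => nu hn jn'.
(* The errors add up to 7 e / 8: at most 4 e / 8 and 2 e / 8 from [near_h] for
   [nu] and for [mu], and e / 8 from [hn]. *)
move=> b' bb'.
have := near_h nu b' bb'.
have : `|shifted_mass mu E b - expect mu h| <= 2 * (1 - expect mu j).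
  by apply: near_h => i; rewrite subrr normr0 divr_gt0.
move: hn jn' jmu; rewrite !ltr_distl !ler_distl.
move: (shifted_mass nu _ _) (shifted_mass mu _ _).
move: (expect mu h) (expect nu h) (expect mu j) (expect nu j).
move=> a1 a2 a3 a4 a5 a6 /andP[? ?] /andP[? ?] ? /andP[? ?] /andP[? ?]; apply/andP; split; lra.
Qed.

End weak_continuity.

(** * The law of the objective *)

Section linear_continuity.
Context {R : realType}.

Lemma mulmx_coord_continuous (k l : nat) (A : 'M[R]_(l, k)) (i : 'I_l) :
  continuous (fun x : 'cV[R]_k => (A *m x) i ord0).
Proof.
apply: (@lipschitz_continuous _ _ _ (\sum_j `|A i j|)) => [|x x' c c0 xx'].
  exact: sumr_ge0.
rewrite !mxE -sumrB mulrC mulr_suml; apply: le_trans (ler_norm_sum _ _ _) _.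
by apply: ler_sum => j _; rewrite -mulrBr normrM ler_wpM2l.
Qed.

Lemma dotp_continuous (k : nat) (c : 'cV[R]_k) : continuous (dotp c).
Proof. exact: mulmx_coord_continuous. Qed.

End linear_continuity.

Section lower_level_cells.
Context {R : realType} {n m s : nat} (D : bilevel_data R n m s).
Variable (ys : seq 'cV[R]_m).
Hypothesis ysE : lower_feasible D = [set` ys].

Definition level_hyperplanes : seq ('I_s * R) :=
  [seq (i, (Wmx D *m y) i ord0) | y <- ys, i <- enum 'I_s].

Definition upper_values : seq R := [seq dotp (qvec D) y | y <- ys].

(** The position of [phi D t] in the list of possible values; the out-of-range
    index [size ys] stands for an infeasible lower level problem. *)
Definition cell (t : 'cV[R]_s) : nat :=
  if phi D t \is a fin_num then index (fine (phi D t)) upper_values else size ys.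

(** The side of the walls on which [t] lies decides which [y] are feasible. *)
Lemma phi_cell_congr (t t' : 'cV[R]_s) :
  (forall l, l \in level_hyperplanes -> (l.2 <= t l.1 ord0) = (l.2 <= t' l.1 ord0)) ->
  phi D t = phi D t'.
Proof.
move=> tt'.
have lev_tt' y : lower_feasible D y -> lev (Wmx D *m y) t <-> lev (Wmx D *m y) t'.
  rewrite ysE => yys.
  have E i : ((Wmx D *m y) i ord0 <= t i ord0) = ((Wmx D *m y) i ord0 <= t' i ord0).
    apply: (tt' (i, (Wmx D *m y) i ord0)); apply/allpairsP.
    by exists (y, i); rewrite mem_enum.
  by split => yt i; [rewrite -E|rewrite E]; exact: yt.
have PsiE : Psi D t = Psi D t'.
  apply/seteqP; split => y [[Fy yt] ymin].
  - split; first by split => //; apply/lev_tt'.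
    by move=> y' Fy' y't'; apply: ymin => //; apply/lev_tt'.
  - split; first by split => //; apply/lev_tt'.
    by move=> y' Fy' y't'; apply: ymin => //; apply/lev_tt'.
by rewrite /phi PsiE.
Qed.

(** [Psi D t] is finite, so that the infimum over it is attained unless it is
    empty, when [phi D t] is infinite. *)
Lemma phi_attained t : phi D t \is a fin_num ->
  exists2 y, y \in ys & phi D t = (dotp (qvec D) y)%:E.
Proof.
rewrite /phi.
have Psi_ys y : Psi D t y -> y \in ys by case=> [[]]; rewrite ysE.
have [[y0 Py0]|nP] := pselect (Psi D t !=set0); last first.
  rewrite (_ : [set _ | _ in _] = set0); first by rewrite ereal_inf0 fin_numE.
  by apply/seteqP; split => [r [y Py _]|//]; apply: nP; exists y.
have [y [Py ymin]] : exists y, Psi D t y /\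
    forall y', Psi D t y' -> dotp (qvec D) y <= dotp (qvec D) y'.
  suff : forall r : seq 'cV[R]_m, (forall y, y \in r -> Psi D t y) ->
      exists y, Psi D t y /\ forall y', y' \in y0 :: r ->
        dotp (qvec D) y <= dotp (qvec D) y'.
    move=> /(_ [seq y <- ys | `[< Psi D t y >]]).
    case=> [y|y [Py ymin]]; first by rewrite mem_filter => /andP[/asboolP].
    exists y; split => // y' Py'; apply: ymin.
    by rewrite inE mem_filter (Psi_ys _ Py') andbT; apply/orP; right; apply/asboolP.
  elim=> [_|y1 r ih rP].
    by exists y0; split => // y'; rewrite inE => /eqP ->.
  have [|y [Py ymin]] := ih; first by move=> y yr; apply: rP; rewrite inE yr orbT.
  have [le|lt] := leP (dotp (qvec D) y) (dotp (qvec D) y1).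
    exists y; split => // y'; rewrite !inE orbCA => /predU1P[->//|h].
    by apply: ymin; rewrite inE.
  exists y1; split; first by apply: rP; rewrite mem_head.
  move=> y'; rewrite !inE orbCA => /predU1P[->//|h].
  by apply: le_trans (ltW lt) (ymin _ _); rewrite inE.
move=> _; exists y; first exact: Psi_ys.
apply/eqP; rewrite eq_le; apply/andP; split.
  by apply: ereal_inf_lbound; exists y.
by apply: le_ereal_inf_tmp => _ [y' Py' <-]; rewrite lee_fin ymin.
Qed.

Lemma cell_fin t : (cell t < size ys)%N = (phi D t \is a fin_num).
Proof.
rewrite /cell; case: ifP => [/phi_attained[y yys ->]|_]; last by rewrite ltnn.
by rewrite -(size_map (dotp (qvec D))) index_mem /= map_f.
Qed.

Lemma phi_cell t : (cell t < size ys)%N -> phi D t = (nth 0 upper_values (cell t))%:E.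
Proof.
rewrite cell_fin => fin; rewrite /cell fin; have [y yys ->] := phi_attained fin.
by rewrite [fine _]/= nth_index// map_f.
Qed.

Lemma cell_determined (C : set nat) : determined level_hyperplanes (cell @^-1` C).
Proof. by move=> t t' tt'; rewrite /cell/= (phi_cell_congr tt'). Qed.

Lemma phi_cell_value (x : 'cV[R]_n) (z : 'cV[R]_s) (B : set R) :
  (objf D @^-1` (EFin @` B)) (x, z) <->
  (cell (Tmx D *m x + z) < size ys)%N /\
  B (dotp (cvec D) x + nth 0 upper_values (cell (Tmx D *m x + z))).
Proof.
rewrite /objf/=; set t := _ + z; split => [[r Br rE]|[lt Br]].
  have fin : phi D t \is a fin_num.
    by move: rE; case: (phi D t) => //=; rewrite ?addeNy ?addey.
  rewrite cell_fin; split => //; have := rE.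
  by rewrite phi_cell ?cell_fin// -EFinD => -[<-].
by exists (dotp (cvec D) x + nth 0 upper_values (cell t)); rewrite // phi_cell.
Qed.

Section laws.
Variables (nu : probability (borelRn R s) R) (x : 'cV[R]_n).

Definition cell_at (z : borelRn R s) : nat := cell (Tmx D *m x + z : 'cV[R]_s).

Lemma cell_at_measurable C : measurable (cell_at @^-1` C).
Proof.
apply: (determined_measurable (f := fun z : borelRn R s => Tmx D *m x + z : 'cV[R]_s)
  _ (cell_determined (C := C))) => i.
apply: eq_measurable_fun (measurable_funD
  (@measurable_cst _ _ _ _ _ ((Tmx D *m x) i ord0)) (borel_coord i)) => z _.
by rewrite [RHS]mxE.
Qed.

Lemma objf_event_measurable (B : set R) : measurable B ->
  measurable (objf D @^-1` (EFin @` B) : set (borelRn R n * borelRn R s)).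
Proof.
move=> mB.
pose f (xz : borelRn R n * borelRn R s) : 'cV[R]_s :=
  Tmx D *m (xz.1 : 'cV[R]_n) + (xz.2 : 'cV[R]_s).
have mf i : measurable_fun setT (fun xz => f xz i ord0).
  apply: (eq_measurable_fun (fun xz : borelRn R n * borelRn R s =>
    (Tmx D *m (xz.1 : 'cV[R]_n)) i ord0 + (xz.2 : 'cV[R]_s) i ord0)).
    by move=> xz _; rewrite /f [RHS]mxE.
  apply: measurable_funD.
    have mT := borel_continuous (@mulmx_coord_continuous _ _ _ (Tmx D) i).
    exact: (measurableT_comp mT measurable_fst).
  exact: (measurableT_comp (borel_coord i) measurable_snd).
pose F i : set (borelRn R n * borelRn R s) := (f @^-1` (cell @^-1` [set i])) `&`
  ((fun xz => dotp (cvec D) (xz.1 : 'cV[R]_n) + nth 0 upper_values i) @^-1` B).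
rewrite (_ : _ @^-1` _ = \big[setU/set0]_(i < size ys) F i).
  apply: bigsetU_measurable => i _; apply: measurableI.
    exact: determined_measurable mf (cell_determined (C := _)).
  rewrite -[X in measurable X]setTI.
  have : measurable_fun setT (fun xz : borelRn R n * borelRn R s =>
      dotp (cvec D) (xz.1 : 'cV[R]_n) + nth 0 upper_values i).
    apply: measurable_funD => //.
    have mc := borel_continuous (@dotp_continuous _ _ (cvec D)).
    exact: (measurableT_comp mc measurable_fst).
  by move=> /(_ measurableT B mB).
apply/seteqP; split => [[y z]|[y z]].
  move=> /phi_cell_value[lt Br].
  by rewrite -bigcup_mkord; exists (cell (Tmx D *m y + z)).
rewrite -bigcup_mkord => -[i /= ilt [ci Br]].
by apply/phi_cell_value; rewrite -/(f (y, z)) ci.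
Qed.

(** Integrating against the Dirac measure at [x] leaves the mass of the section
    of the event at [x], and that section is a union of cells. *)
Lemma objf_lawE (B : set R) : measurable B ->
  objf_law D x nu B = nu (cell_at @^-1`
    [set i | (i < size ys)%N /\ B (dotp (cvec D) x + nth 0 upper_values i)]).
Proof.
move=> mB; have mO := objf_event_measurable mB.
rewrite /objf_law /product_measure1 integral_dirac//; last exact: measurable_fun_xsection.
rewrite diracT mul1e/=; congr (nu _).
apply/seteqP; split => z.
  by rewrite xsectionE => /phi_cell_value.
by rewrite xsectionE => h; apply/phi_cell_value.
Qed.

Hypotheses (Xx : Xset D x) (MXnu : MX D nu).

(** [phi] may be infinite off the support, but the support has full measure. *)
Lemma cell_at_ae : {ae nu, forall z, (cell_at z < size ys)%N}.
Proof.
apply: negligibleS (support_ae nu) => z; apply: contra_not => nuz.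
have /MXnu : (Xset D `*` Defs.support nu) (x, z) by [].
rewrite /Defs.domf/= /objf/= /cell_at cell_fin.
by case: (phi D _).
Qed.

Lemma cell_mass_sum :
  \sum_(i < size ys) prb nu (cell_at @^-1` [set val i]) = 1.
Proof.
rewrite -(@prb_bigU _ _ _ nu (size ys) (fun i => cell_at @^-1` [set i])).
- rewrite -(bigcup_mkord _ (fun i => cell_at @^-1` [set i])) -(prbT nu).
  rewrite /prb; congr fine.
  have mC : measurable (cell_at @^-1` `I_(size ys)) by exact: cell_at_measurable.
  rewrite (_ : \bigcup_(i in _) _ = cell_at @^-1` `I_(size ys)); last first.
    apply/seteqP; split => [z [i /= ilt zi]|z zlt]; last by exists (cell_at z).
    by rewrite /preimage/= zi.
  have /negligibleP : nu.-negligible (~` (cell_at @^-1` `I_(size ys))).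
    exact: cell_at_ae.
  move=> /(_ (measurableC mC)) C0.
  rewrite -[in RHS](setvU (cell_at @^-1` `I_(size ys))) setUC measureU0//.
  exact: measurableC.
- by move=> i; exact: cell_at_measurable.
- by move=> i j _ _ [z [<- <-]].
Qed.

End laws.

End lower_level_cells.

Section risk_representation.
Context {R : realType} {n m s : nat} (D : bilevel_data R n m s).
Variable (ys : seq 'cV[R]_m).
Hypothesis ysE : lower_feasible D = [set` ys].
Context d {Omega : measurableType d} (P : probability Omega R).
Context (p : R) (p1 : (1 <= p%:E)%E) (rho : LfunType P p1 -> R).
Hypothesis rho_law : law_invariant rho.

Lemma fibre_measurable_fun (K : Omega -> nat) (a : nat -> R) :
  (forall i, measurable (K @^-1` [set i])) -> measurable_fun setT (a \o K).
Proof.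
move=> mK _ B mB; rewrite setTI.
rewrite (_ : _ @^-1` _ = \bigcup_(i in a @^-1` B) (K @^-1` [set i])).
  by apply: bigcup_measurable => i _.
by apply/seteqP; split => [x Bx|x [i Bi xi]]; [exists (K x)|rewrite /preimage/= xi].
Qed.

(** The law of [objf x] under [nu] is the image of the law of the cell index,
    so every realisation of that law on [Omega] computes the risk. *)
Lemma Qrho_cell_coding (x : 'cV[R]_n) (nu : probability (borelRn R s) R)
    (K : Omega -> nat) :
  (forall i, measurable (K @^-1` [set i])) ->
  (forall w, (K w < size ys)%N) ->
  (forall i, (i < size ys)%N ->
    prb P (K @^-1` [set i]) = prb nu (cell_at D ys x @^-1` [set i])) ->
  exists2 Z : LfunType P p1,
    (forall w, Z w = dotp (cvec D) x + nth 0 (upper_values D ys) (K w)) &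
    Qrho D rho x nu = rho Z.
Proof.
move=> mK KN Kmass.
pose a i := dotp (cvec D) x + nth 0 (upper_values D ys) i.
have maK := fibre_measurable_fun a mK.
have aKL : a \o K \in Lfun P p%:E.
  apply: (@Lfun_bounded _ _ _ _ _ p1 _ (\sum_(i < size ys) `|a i|)) => // w.
  by rewrite (bigD1 (Ordinal (KN w)))//= lerDl sumr_ge0.
pose Z := Lfun_Sub p1 aKL.
have ZE : forall B : set (measurableTypeR R), measurable B ->
    distribution P Z B = objf_law D x nu B.
  move=> B mB; rewrite (objf_lawE ysE)//.
  set C := [set i | _].
  have -> : distribution P Z B = P (K @^-1` C).
    congr (P _); apply/seteqP; split => w; first by split.
    by case.
  rewrite (_ : K @^-1` C = \bigcup_(i in C) (K @^-1` [set i])); last first.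
    by apply/seteqP; split => [w Cw|w [i Ci wi]]; [exists (K w)|rewrite /preimage/= wi].
  rewrite (_ : _ @^-1` C = \bigcup_(i in C) (cell_at D ys x @^-1` [set i])); last first.
    by apply/seteqP; split => [w Cw|w [i Ci wi]];
      [exists (cell_at D ys x w)|rewrite /preimage/= wi].
  have mc i : measurable (cell_at D ys x @^-1` [set i]) by exact: cell_at_measurable.
  rewrite !measure_bigcup//; [|by move=> i j _ _ [w [<- <-]]|by move=> i j _ _ [w [<- <-]]].
  apply: eq_eseriesr => i; rewrite inE => -[iN _].
  by apply: etrans (prbE P (mK i)) _; rewrite Kmass//; exact/esym/prbE.
exists Z => //; apply: rho_law => B mB; rewrite ZE//.
pose law := [set Z : LfunType P p1 | forall B : set (measurableTypeR R),
  measurable B -> distribution P Z B = objf_law D x nu B].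
have : law (objf_rv D x nu) by apply: (@xgetPex _ 0 law); exists Z.
exact.
Qed.

End risk_representation.

(** * Compactness of the localized feasible set *)

Section compactness.
Context {R : realType}.

Lemma ler_mx_norm_coord (k l : nat) (A : 'M[R]_(k, l)) (i : 'I_k) (j : 'I_l) :
  `|A i j| <= `|A|.
Proof.
rewrite [leRHS]/Num.Def.normr/= mx_normrE.
exact: (le_bigmax_cond _ (fun ij : 'I_k * 'I_l => `|A ij.1 ij.2|)
  (erefl true : xpredT (i, j))).
Qed.

Lemma mx_norm_le (k l : nat) (A : 'M[R]_(k, l)) (c : R) : 0 <= c ->
  (forall i j, `|A i j| <= c) -> `|A| <= c.
Proof.
move=> c0 Ac; rewrite [leLHS]/Num.Def.normr/= mx_normrE.
by apply/bigmax_leP; split => // -[i j] _; exact: Ac.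
Qed.

Lemma trmx_continuous (k l : nat) : continuous (@trmx R k l).
Proof.
move=> A B [Q nQ sQB]; exists (fun i j => Q j i) => [i j|C CQ].
  by have := nQ j i; rewrite mxE.
by apply: sQB => i j; rewrite mxE.
Qed.

Lemma bounded_closed_compact_cV (k : nat) (K : set 'cV[R]_k) :
  bounded_set K -> closed K -> compact K.
Proof.
move=> [M [Mreal KM]] cK.
have -> : K = (@trmx R 1 k) @` [set v | K v^T].
  apply/seteqP; split => [v Kv|_ [v Kv <-]//].
  by exists v^T; rewrite /= trmxK.
apply: continuous_compact.
  by apply: continuous_subspaceT; exact: trmx_continuous.
apply: bounded_closed_compact.
  exists (Num.max M 0); split; first exact: num_real.
  move=> y; rewrite gt_max => /andP[My y0] v Kv.
  apply: mx_norm_le => [|i j]; first exact: ltW.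
  have := KM _ My _ Kv; apply: le_trans.
  by have := ler_mx_norm_coord v^T j i; rewrite mxE.
apply: (@preimage_closed _ _ (@trmx R 1 k)) => // v _.
exact: trmx_continuous.
Qed.

Lemma polyhedron_closed (k : nat) (X : set 'cV[R]_k) : polyhedron X -> closed X.
Proof.
move=> [l [A [b ->]]].
rewrite (_ : [set x | _] =
    \bigcap_(i in setT) ((fun x => (A *m x) i ord0) @^-1` [set r | r <= b i ord0])).
  apply: closed_bigI => i _.
  apply: preimage_closed; last exact: closed_le.
  by move=> x _; exact: mulmx_coord_continuous.
by apply/seteqP; split => x /= h => [i _|i]; exact: h.
Qed.

Lemma bounded_closure (k : nat) (V : set 'cV[R]_k) : bounded_set V ->
  bounded_set (closure V).
Proof.
move=> [M [Mreal VM]]; exists M; split => // y My x clx.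
have cl : closed [set x : 'cV[R]_k | `|x| <= y].
  apply: (@preimage_closed _ _ (fun x : 'cV[R]_k => `|x|) [set r | r <= y]);
    last exact: closed_le.
  by move=> z _; exact: norm_continuous.
have Vy : V `<=` [set x : 'cV[R]_k | `|x| <= y] by exact: VM.
by have := closureS Vy clx; rewrite -(closure_id _).1.
Qed.

End compactness.

(** * Joint continuity and stability *)

Lemma filter_prod_intro (T U : Type) (F : set_system T) (G : set_system U)
  (A : set T) (B : set U) (C : set (T * U)) : F A -> G B ->
  (forall x y, A x -> B y -> C (x, y)) -> filter_prod F G C.
Proof. by move=> FA GB ABC; exists (A, B) => // -[x y] []; exact: ABC. Qed.

Section joint_continuity.
Context {R : realType} {n m s : nat} (D : bilevel_data R n m s).
Hypothesis Y_finite : finite_set (lower_feasible D).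
Context d {Omega : measurableType d} (P : probability Omega R).
Hypothesis P_atomless : atomless P.
Context (p : R) (p1 : (1 <= p%:E)%E) (rho : LfunType P p1 -> R).
Hypotheses (rho_convex : risk_convex rho) (rho_mono : risk_nondecreasing rho)
  (rho_law : law_invariant rho).
Variables (M : set (probRn R s)) (mu : probRn R s).
Hypotheses (M_sub : M `<=` MX D) (M_mu : M mu) (mu_density : bounded_lebesgue_density mu).

(** The cell masses depend continuously on [(x, nu)] at [(x0, mu)], the walls of
    the cells being [mu]-null; realising nearby laws by [atomless_coupling]
    turns this into closeness of random variables outside an event of small
    probability, so that [risk_continuous_in_probability] applies. *)
Lemma Qrho_jointly_continuous (x0 : 'cV[R]_n) (e : R) : Xset D x0 -> 0 < e ->
  filter_prod (nbhs x0) (within M (nbhs mu))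
    [set q | Xset D q.1 -> `|Qrho D rho q.1 q.2 - Qrho D rho x0 mu| < e].
Proof.
move=> Xx0 e0.
have [ys ysE] := (finite_seqP _).1 Y_finite.
pose N := size ys; pose v := upper_values D ys.
pose w (nu : probability (borelRn R s) R) x i := prb nu (cell_at D ys x @^-1` [set i]).
have w0 nu x i : 0 <= w nu x i by exact: prb_ge0.
have w1 nu x : M nu -> Xset D x -> \sum_(i < N) w nu x i = 1.
  by move=> Mnu Xx; apply: (cell_mass_sum ysE) => //; exact: M_sub.
have N0 : (0 < N)%N.
  rewrite lt0n; apply/eqP => N0; have := w1 mu x0 M_mu Xx0.
  by rewrite N0 big_ord0 => /eqP; rewrite eq_sym oner_eq0.
have [|K0 [mK0 K0N K0w _]] := atomless_coupling P_atomless (N := N) (K := cst 0%N)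
    _ (fun=> N0) (w0 mu x0) (w1 mu x0 M_mu Xx0).
  by move=> i; rewrite preimage_cst; case: ifP.
have [Z0 Z0E QZ0] := Qrho_cell_coding ysE rho_law mK0 K0N K0w.
(* [h] bounds the difference of two realisations as soon as their linear parts
   differ by at most [1]. *)
pose h : R := 1 + 2 * \sum_(i < N) `|nth 0 v i|.
have h0 : 0 <= h by rewrite addr_ge0// mulr_ge0// sumr_ge0.
have [del del0 Zcont] := risk_continuous_in_probability rho_convex rho_mono Z0 h0 e0.
pose eta := del / N.+1%:R.
have eta0 : 0 < eta by rewrite divr_gt0.
have near_w (i : 'I_N) : filter_prod (nbhs x0) (within M (nbhs mu))
    [set q | `|w q.2 q.1 i - w mu x0 i| < eta].
  have [dl dl0 nearmu] := weak_cell_continuous (Tmx D *m x0)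
    (cell_determined ysE (C := [set val i]))
    (fun i a => density_hyperplane i a mu_density) eta0.
  have nearx : nbhs x0 [set x | forall j, `|(Tmx D *m x) j ord0 - (Tmx D *m x0) j ord0| < dl].
    apply: (@filter_forall _ _ (fun j x => `|(Tmx D *m x) j ord0 - (Tmx D *m x0) j ord0| < dl)
      (nbhs x0)) => j.
    have /cvgrPdistC_lt := @mulmx_coord_continuous _ _ _ (Tmx D) j x0.
    exact.
  apply: (filter_prod_intro nearx (_ : within M (nbhs mu) [set nu | forall b' : 'cV[R]_s,
      (forall j, `|b' j ord0 - (Tmx D *m x0) j ord0| < dl) ->
      `|shifted_mass nu (cell D ys @^-1` [set val i]) b' - w mu x0 i| < eta])).
    exact: (cvg_within M nearmu).
  by move=> x nu nx; exact.
have near_c : nbhs x0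
    [set x | `|dotp (cvec D) x - dotp (cvec D) x0| < Num.min del 1].
  have /cvgrPdistC_lt := @dotp_continuous _ _ (cvec D) x0.
  by apply; rewrite lt_min del0 ltr01.
have near_M : within M (nbhs mu) M by exact: withinT.
have FF : Filter (filter_prod (nbhs x0) (within M (nbhs mu))) by exact: filter_prod_filter.
have near_all := filter_forall FF near_w.
have near_cM : filter_prod (nbhs x0) (within M (nbhs mu))
    [set q | `|dotp (cvec D) q.1 - dotp (cvec D) x0| < Num.min del 1 /\ M q.2].
  exact: (filter_prod_intro near_c near_M).
apply: filterS2 near_all near_cM => -[x nu]/= wclose [cclose Mnu] Xx.
have [K [mK KN Kw [A [mA KA PA]]]] :=
  atomless_coupling P_atomless mK0 K0N (w0 nu x) (w1 nu x Mnu Xx).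
have [Z ZE QZ] := Qrho_cell_coding ysE rho_law mK KN Kw.
rewrite QZ QZ0; apply: (Zcont Z A) => //.
- apply: le_trans PA _.
  apply: (@le_trans _ _ (\sum_(i < N) eta)).
    by apply: ler_sum => i _; rewrite (K0w _ (ltn_ord i)); exact: ltW (wclose i).
  rewrite sumr_const card_ord /eta -mulrnAr -mulr_natr ger_pMr//.
  by rewrite mulrC ler_pdivrMr// mul1r ler_nat.
- move=> a nAa; rewrite ZE Z0E KA// opprD addrACA subrr addr0.
  by apply: ltW; apply: lt_le_trans cclose _; rewrite ge_min lexx.
- have vN i : (i < N)%N -> `|nth 0 v i| <= \sum_(i < N) `|nth 0 v i|.
    by move=> iN; rewrite (bigD1 (Ordinal iN))//= lerDl sumr_ge0.
  move=> a; rewrite ZE Z0E opprD addrACA.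
  apply: le_trans (ler_normD _ _) _; rewrite /h lerD//.
    by apply: ltW; apply: lt_le_trans cclose _; rewrite ge_min lexx orbT.
  apply: le_trans (ler_normB _ _) _.
  by rewrite mulrDl !mul1r lerD ?vN.
Qed.

Lemma Qrho_weakly_continuous (x : 'cV[R]_n) (e : R) : Xset D x -> 0 < e ->
  \forall nu \near within M (nbhs mu), `|Qrho D rho x nu - Qrho D rho x mu| < e.
Proof.
move=> Xx e0; have [[U W]/= [xU WM] UW] := Qrho_jointly_continuous Xx e0.
apply: filterS WM => nu Wnu.
by apply: (UW (x, nu)) => //; split => //=; exact: nbhs_singleton xU.
Qed.

Lemma xiV_usc (V : set 'cV[R]_n) : usc_within_at M (xiV D rho V) mu.
Proof.
move=> a /ereal_inf_lt[_ [x [Xx Vx] <-]]; rewrite lte_fin => Qa.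
have e0 : 0 < a - Qrho D rho x mu by rewrite subr_gt0.
apply: filterS (Qrho_weakly_continuous Xx e0) => nu.
rewrite ltr_distl => /andP[_ Qnu].
apply: (@le_lt_trans _ _ (Qrho D rho x nu)%:E); last by rewrite lte_fin; lra.
by apply: ereal_inf_lbound; exists x.
Qed.

Lemma Qrho_gt_on_compact (K : set 'cV[R]_n) (r e : R) : compact K -> K `<=` Xset D ->
  0 < e -> (forall x, K x -> r <= Qrho D rho x mu) ->
  \forall nu \near within M (nbhs mu), forall x, K x -> r - e < Qrho D rho x nu.
Proof.
move=> /compact_near_coveringP cK KX e0 rK.
pose B nu x := Xset D x -> r - e < Qrho D rho x nu.
have : \forall nu \near within M (nbhs mu), K `<=` B nu.
  apply: cK => x Kx.
  apply: filterS (Qrho_jointly_continuous (KX x Kx) e0) => -[y nu]/= Qy Xy.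
  move: (Qy Xy); rewrite ltr_distl => /andP[+ _].
  by have := rK x Kx; rewrite /=; lra.
by apply: filterS => nu KB x Kx; apply: KB => //; exact: KX.
Qed.

Section clm.
Hypothesis X_closed : closed (Xset D).
Variable V : set 'cV[R]_n.
Hypotheses (V_bounded : bounded_set V) (V_clm : CLM_set D rho V mu).

Let feasible := Xset D `&` closure V.

Let feasible_compact : compact feasible.
Proof.
apply: bounded_closed_compact_cV; last by apply: closedI => //; exact: closed_closure.
have [B [Breal VB]] := bounded_closure V_bounded.
by exists B; split => // y By x [_ /VB]; exact.
Qed.

Lemma xiV_attained x : XiV D rho V mu x -> xiV D rho V mu = (Qrho D rho x mu)%:E.
Proof.
move=> [Fx xmin]; apply/eqP; rewrite eq_le; apply/andP; split.
  by apply: ereal_inf_lbound; exists x.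
by apply: le_ereal_inf_tmp => _ [y Fy <-]; rewrite lee_fin xmin.
Qed.

Lemma xiV_continuous : continuous_within_at M (xiV D rho V) mu.
Proof.
have [[x Xix] _] := V_clm; have [Fx xmin] := Xix.
have xiE := xiV_attained Xix; set r := Qrho D rho x mu in xiE.
have close e : 0 < e -> \forall nu \near within M (nbhs mu),
    ((r - e)%:E <= xiV D rho V nu < (r + e)%:E)%E.
  move=> e0.
  have up : \forall nu \near within M (nbhs mu), (xiV D rho V nu < (r + e)%:E)%E.
    by apply: xiV_usc; rewrite xiE lte_fin ltrDl.
  have lo := Qrho_gt_on_compact feasible_compact (fun _ => @proj1 _ _) e0 xmin.
  apply: filterS2 up lo => nu up lo; rewrite up andbT.
  by apply: le_ereal_inf_tmp => _ [y Fy <-]; rewrite lee_fin ltW// lo.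
rewrite /continuous_within_at xiE; apply/fine_cvgP; split.
  apply: filterS (close 1 ltr01) => nu /andP[lo up].
  by rewrite fin_real// (lt_le_trans _ lo) ?ltNyr// (lt_trans up) ?ltry.
apply/cvgrPdistC_le => e e0.
apply: filterS (close e e0) => nu /andP[]; rewrite [(fine \o _) _]/=.
case: (xiV D rho V nu) => //= a; rewrite lee_fin lte_fin => lo up.
by rewrite ler_distl lo ltW.
Qed.

(** Outside [O] the objective exceeds the optimal value on a compact set, by
    continuity with a margin that survives small changes of the measure. *)
Lemma XiV_berge_usc : berge_usc_within_at M (XiV D rho V) mu.
Proof.
move=> O oO XiO.
have [[x Xix] _] := V_clm; have [[Xx Vx] xmin] := Xix.
pose K := feasible `&` ~` O.
have cK : compact K.
  apply: (subclosed_compact _ feasible_compact); last by move=> y [].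
  apply: closedI; last exact: open_closedC.
  exact: compact_closed.
have better : \forall nu \near within M (nbhs mu),
    K `<=` [set y | Xset D y -> Qrho D rho x nu < Qrho D rho y nu].
  apply: ((compact_near_coveringP K).1 cK) => y [[Xy Vy] nOy].
  have xy : Qrho D rho x mu < Qrho D rho y mu.
    rewrite ltNge; apply/negP => yx; apply: nOy; apply: XiO; split => // z Fz.
    exact: le_trans yx (xmin z Fz).
  pose e := (Qrho D rho y mu - Qrho D rho x mu) / 2.
  have e0 : 0 < e by rewrite divr_gt0// subr_gt0.
  have nx : filter_prod (nbhs y) (within M (nbhs mu))
      [set q | `|Qrho D rho x q.2 - Qrho D rho x mu| < e].
    by apply: (filter_prod_intro (filterT : nbhs y setT) (Qrho_weakly_continuous Xx e0)).
  apply: filterS2 nx (Qrho_jointly_continuous Xy e0) => -[z nu]/= Qx Qz Xz.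
  move: Qx (Qz Xz); rewrite /e !ltr_distl => /andP[_ ?] /andP[? _]; lra.
have [N [oN Nmu] NK] : exists2 N, open_nbhs mu N & N `<=` [set nu | M nu ->
    K `<=` [set y | Xset D y -> Qrho D rho x nu < Qrho D rho y nu]].
  by move: better; rewrite /within/= nbhsE => -[N oN NK]; exists N.
exists N; split => // nu Nnu Mnu y [[Xy Vy] ymin].
apply: contrapT => nOy.
have := NK nu Nnu Mnu y (conj (conj Xy Vy) nOy) Xy.
by rewrite ltNge ymin.
Qed.

End clm.
End joint_continuity.

Theorem theorem5p2 (R : realType) (n m s : nat) (D : bilevel_data R n m s)
    (X_polyhedron : polyhedron (Xset D)) (X_nonempty : Xset D !=set0)
    (Y_nonempty : Yset D `&` integral_vectors !=set0)
    (Y_finite : finite_set (Yset D `&` integral_vectors))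
    (p : R) (p1 : (1 <= p%:E)%E)
    (disp : measure_display) (Omega : measurableType disp)
    (P : probability Omega R) (P_atomless : atomless P)
    (rho : LfunType P p1 -> R)
    (rho_convex : risk_convex rho) (rho_nondecreasing : risk_nondecreasing rho)
    (rho_law_invariant : law_invariant rho)
    (M : set (probRn R s)) (M_sub : M `<=` MX D)
    (M_integrating : locally_uniformly_integrating p M)
    (mu : probRn R s) (M_mu : M mu) (mu_density : bounded_lebesgue_density mu) :
  usc_within_at M (xiV D rho setT) mu /\
  forall V : set 'cV[R]_n, open V -> bounded_set V -> CLM_set D rho V mu ->
    continuous_within_at M (xiV D rho V) mu /\
    berge_usc_within_at M (XiV D rho V) mu.
Proof.
split; first exact: xiV_usc.
move=> V _ V_bounded V_clm.
have X_closed := polyhedron_closed X_polyhedron.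
by split; [exact: xiV_continuous|exact: XiV_berge_usc].
Qed.
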